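(* Let $\mathscr H$ be a complex Hilbert space and let $A_j,B_j\in\mathbb B(\mathscr H)$ $(1\le j\le n)$ satisfy $0<mA_j\le B_j\le MA_j$ for $1\le j\le n$ and $$0<m\Big(I_{\mathscr H}-\sum_{j=1}^nA_j\Big)\le I_{\mathscr H}-\sum_{j=1}^nB_j\le M\Big(I_{\mathscr H}-\sum_{j=1}^nA_j\Big)$$ for some positive real numbers $m,M$ such that $m<1<M$, and let $p\in[0,1]$. Then $$\delta\left(f(m)^p\Big(\sum_{j=1}^nA_j\Big)+\Big(I_{\mathscr H}-\sum_{j=1}^nA_j\Big)\sigma_{((1-\lambda)+\lambda t)^p}\Big(I_{\mathscr H}-\sum_{j=1}^nB_j\Big)\right)\ge\left(I_{\mathscr H}-\Big(\sum_{j=1}^nA_j\sigma_fB_j\Big)\right)^p,$$ where $$\delta=\frac{p^p\,(f(M)-f(m))\,\big(f(M)f(m)^p-f(m)f(M)^p\big)^{p-1}}{(1-p)^{p-1}\big(f(M)^p-f(m)^p\big)^p}$$ and $f(t)=(1-\lambda)+\lambda t$ $(\lambda\in[0,1])$.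
   Context: $\mathbb B(\mathscr H)$ is the algebra of bounded linear operators on $\mathscr H$, with identity $I_{\mathscr H}$. $A\ge0$ means $\langle Ax,x\rangle\ge0$ for all $x$; $A>0$ means $A\ge0$ and $A$ is invertible; $A\le B$ means $B-A\ge0$ for self-adjoint $A,B$. For a positive operator monotone function $g$ on $(0,\infty)$ and positive invertible $A,B$, $A\sigma_gB=A^{1/2}g(A^{-1/2}BA^{-1/2})A^{1/2}$. In particular, for $f(t)=(1-\lambda)+\lambda t$, $A\sigma_fB=(1-\lambda)A+\lambda B$, and $\sigma_{((1-\lambda)+\lambda t)^p}$ is the operation with representing function $t\mapsto((1-\lambda)+\lambda t)^p$. Powers of positive operators are defined by functional calculus.
   Formalization: For λ = 0 the displayed formula for δ is undefined (f(M) = f(m) = 1 gives 0/0); there δ is taken to be its limit value 1. For λ > 0 the formula is as displayed, with 0^0 = 1 at p = 0 and p = 1. *)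

(* Defs.v *)
From HB Require Import structures.
From mathcomp Require Import all_boot all_order all_algebra sesquilinear.
From mathcomp Require Import complex.
From mathcomp Require Import all_classical all_reals all_analysis.

Set Implicit Arguments.
Unset Strict Implicit.
Unset Printing Implicit Defensive.

Import Order.TTheory GRing.Theory Num.Theory.
Import numFieldNormedType.Exports.

Local Open Scope classical_set_scope.
Local Open Scope ring_scope.
Local Open Scope complex_scope.

(* The inner product is linear in its first argument and conjugate-linear in
   the second. *)
HB.mixin Record isHilbert (R : realType) H
    of CompleteNormedModule R[i] H := {
  inner : {dot H for Num.conj} ;
  innerxx : forall x : H, inner x x = `|x| ^+ 2
}.

#[short(type="hilbertType")]
HB.structure Definition Hilbert (R : realType) :=
  {H of isHilbert R H & CompleteNormedModule R[i] H}.

Section operators.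
Context {R : realType} {H : hilbertType R}.
Implicit Types (A B S T : H -> H) (g : R -> R).

Definition bounded_op T := linear T /\ continuous T.

Definition selfadjoint T := forall x y, inner (T x) y = inner x (T y).

(* On R[i], 0 <= z means that z is real and nonnegative. *)
Definition op_ge0 T := forall x, 0 <= inner (T x) x.

Definition op_invertible T :=
  exists S, [/\ bounded_op S, S \o T = idfun & T \o S = idfun].

Definition op_gt0 T := op_ge0 T /\ op_invertible T.

Definition op_le S T := [/\ selfadjoint S, selfadjoint T & op_ge0 (T - S)].

Definition spectrum T : set R[i] :=
  [set z | ~ op_invertible (T - z *: (idfun : H -> H))].

Definition poly_op (q : {poly R}) T : H -> H :=
  \sum_(k < size q) (q`_k)%:C *: iter k T.

(* S = g(T) in the continuous functional calculus of a self-adjoint T: S is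
   the limit, in operator norm, of q_n(T) for real polynomials q_n converging
   to g uniformly on the spectrum of T, which is a subset of R. *)
Definition is_funcalc g T S := bounded_op S /\
  exists q : nat -> {poly R},
    (forall e : R, 0 < e -> \forall n \near \oo,
       forall t : R, spectrum T t%:C -> `|(q n).[t] - g t| <= e) /\
    (forall e : R, 0 < e -> \forall n \near \oo,
       forall x : H, `|poly_op (q n) T x - S x| <= e%:C * `|x|).

(* g(T); the default value 0 is only reached outside the domain of the
   functional calculus. *)
Definition funcalc g T : H -> H := xget (0 : H -> H) (is_funcalc g T).

Definition op_pow T (p : R) : H -> H := funcalc (fun t => t `^ p) T.

Definition op_mean g A B : H -> H :=
  op_pow A 2^-1 \o
    funcalc g (op_pow A (- 2^-1) \o B \o op_pow A (- 2^-1)) \o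
  op_pow A 2^-1.

End operators.

Section constant.
Context {R : realType}.

Definition aff (lam t : R) : R := (1 - lam) + lam * t.

(* For lam = 0 the quotient reads 0 / 0; it is given its limit value 1 as lam
   tends to 0. For p = 0 and p = 1 the convention is 0 `^ 0 = 1. *)
Definition delta (lam p m M : R) : R :=
  let fm := aff lam m in
  let fM := aff lam M in
  if lam == 0 then 1 else
  (p `^ p * (fM - fm) * (fM * fm `^ p - fm * fM `^ p) `^ (p - 1)) /
  ((1 - p) `^ (p - 1) * (fM `^ p - fm `^ p) `^ p).

End constant.

(* Main.v *)
(* Write C, D for I minus the sums of the A_j, B_j and Y for I minus the sum of
   the A_j sigma_f B_j. Since f is affine, Y = (1 - lam) C + lam D = C sigma_f D.
   Let al t + be be the chord of t^p over [f(m), f(M)]. By concavity it lies below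
   t^p there, so C sigma_(f^p) D >= al Y + be C. As C <= I and
   f(m)^p - be = al f(m) >= 0, adding f(m)^p (I - C) gives at least al Y + be.
   For lam > 0, delta is the maximum over t > 0 of t^p / (al t + be), hence
   Y^p <= delta (al Y + be); for lam = 0 this reads C^p <= I.

   Monotonicity and uniqueness of the functional calculus rest on the fact that
   a real polynomial q >= 0 on the spectrum of a self-adjoint T satisfies
   q(T) >= 0. *)
From HB Require Import structures.
Require Import Defs.
From mathcomp Require Import all_boot all_order all_algebra sesquilinear.
From mathcomp Require Import complex.
From mathcomp Require Import all_classical all_reals all_analysis.
From mathcomp Require Import ring lra.

Import Order.TTheory GRing.Theory Num.Theory.
Import numFieldNormedType.Exports.

Set Implicit Arguments.
Unset Strict Implicit.
Unset Printing Implicit Defensive.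

Local Open Scope classical_set_scope.
Local Open Scope ring_scope.
Local Open Scope complex_scope.

(** Each operator inequality compares two functions of one self-adjoint operator, so it reduces to a
    scalar inequality on a spectrum: that of C^(-1/2) D C^(-1/2) for the mean, that of Y for the
    power. The first lies in [m, M], so that f maps it into the segment of the chord. The second can
    reach below f(m), because C may be small; this is why t^p <= delta (al t + be) is proved for
    every t > 0 when lam > 0, by weighted AM-GM. As [funcalc] picks some operator satisfying
    [is_funcalc], computing with it takes existence and uniqueness. Existence comes from Bernstein
    polynomials, whose error is explicit for Lipschitz functions; powers are Lipschitz on segments
    of positive numbers, where the spectra in question lie. *)

(** * Polynomial approximation and real powers *)

Section scalar.
Context {R : realType}.
Implicit Types (a b c x y t r p : R).

(* The Bernstein polynomial of h, as the expectation of h at a binomial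
   variable, by conditioning on the first trial. *)
Fixpoint bernstein n (h : nat -> R) : {poly R} :=
  if n is n'.+1 then
    'X * bernstein n' (fun k => h k.+1) + (1 - 'X) * bernstein n' h
  else (h 0%N)%:P.

Lemma bernsteinS n h x : (bernstein n.+1 h).[x] =
  x * (bernstein n (fun k => h k.+1)).[x] + (1 - x) * (bernstein n h).[x].
Proof. by rewrite /= !hornerE. Qed.

Lemma bernstein_le n h h' x : 0 <= x <= 1 ->
  (forall k, (k <= n)%N -> h k <= h' k) -> (bernstein n h).[x] <= (bernstein n h').[x].
Proof.
move=> /andP[x0 x1]; elim: n h h' => [|n IH] h h' hh; first by rewrite !hornerC hh.
rewrite !bernsteinS; apply: lerD; apply: ler_wpM2l; rewrite ?subr_ge0//; apply: IH => k kn.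
  exact: hh.
by apply: hh; exact: leqW.
Qed.

Lemma bernstein_affine n h a b x :
  (bernstein n (fun k => a + b * h k)).[x] = a + b * (bernstein n h).[x].
Proof.
by elim: n h => [|n IH] h; [rewrite !hornerC | rewrite !bernsteinS !IH; ring].
Qed.

(** The centre c is free because conditioning on the first trial shifts it to c - 1. At c = n x only
    the binomial variance n x (1 - x) remains. *)
Lemma bernstein_variance n c x :
  (bernstein n (fun k => (k%:R - c) ^+ 2)).[x] = n%:R * x * (1 - x) + (n%:R * x - c) ^+ 2.
Proof.
elim: n c => [|n IH] c; first by rewrite hornerC; ring.
rewrite bernsteinS IH.
have -> : (fun k => (k.+1%:R - c) ^+ 2) = (fun k => (k%:R - (c - 1)) ^+ 2) :> (nat -> R).
  by apply/funext => k; rewrite -natr1; congr (_ ^+ 2); ring.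
by rewrite IH -natr1; ring.
Qed.

Definition lipschitz_seg a b (g : R -> R) := exists2 L : R, 0 < L &
  forall s t, a <= s <= b -> a <= t <= b -> `|g s - g t| <= L * `|s - t|.

Definition poly_approx (q : nat -> {poly R}) (D : R -> Prop) (g : R -> R) :=
  forall e : R, 0 < e -> \forall n \near \oo, forall t, D t -> `|(q n).[t] - g t| <= e.

(** Chebyshev's argument: |u| <= d + u^2 / d turns the Lipschitz bound at a node into an affine
    function of the squared deviation, whose expectation is the variance. Using n + 1 trials avoids
    dividing by 0 in the nodes. *)
Lemma lipschitz_poly_approx a b g : a < b -> lipschitz_seg a b g ->
  exists q, poly_approx q (fun t => a <= t <= b) g.
Proof.
move=> ab [L L0 gL]; pose w := b - a; have w0 : 0 < w by rewrite subr_gt0.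
pose node n k := a + w * (k%:R / n%:R).
exists (fun n => bernstein n.+1 (fun k => g (node n.+1 k)) \Po (w^-1 *: ('X - a%:P))).
(* With this d the final error L w (d + 1 / (N d)), where 1 / N < d^2, is at most L w (d + d) =
   e. *)
move=> e e0; pose d := e / (2 * L * w); have d0 : 0 < d by rewrite divr_gt0// !mulr_gt0.
have d2 : 0 < d ^+ 2 by rewrite exprn_gt0.
have [n0 _ hn0] := near_infty_natSinv_lt (PosNum d2).
exists n0 => // n /hn0 /= nd t /andP[at_ tb]; rewrite horner_comp hornerZ hornerXsubC.
set x := w^-1 * (t - a).
have tE : t = a + w * x by rewrite /x mulVKf ?gt_eqF// addrC subrK.
have x0 : 0 <= x by rewrite mulr_ge0 ?subr_ge0// invr_ge0 ltW.
have x1 : x <= 1 by rewrite /x ler_pdivrMl// mulr1 lerB.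
have x01 : 0 <= x <= 1 by rewrite x0.
pose N : R := n.+1%:R; have N0 : 0 < N by rewrite ltr0n.
rewrite -/N in nd.
pose v k : R := (k%:R - N * x) ^+ 2.
pose al := L * w * d; pose be := L * w / (d * N ^+ 2).
have be0 : 0 <= be by rewrite ltW// divr_gt0// mulr_gt0// exprn_gt0.
have hv k : (k <= n.+1)%N -> `|g (node n.+1 k) - g t| <= al + be * v k.
  move=> kn; have kN : 0 <= k%:R / N <= 1.
    by rewrite divr_ge0 ?ler0n ?(ltW N0)//= ler_pdivrMr// mul1r ler_nat.
  have nodek : a <= node n.+1 k <= b.
    have /andP[k0 k1] := kN; rewrite /node -/N lerDl mulr_ge0 ?(ltW w0)//=.
    by rewrite -lerBrDl -/w ger_pMr.
  apply: le_trans (gL _ _ nodek _) _; first by rewrite at_.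
  have -> : node n.+1 k - t = w * (k%:R / N - x) by rewrite {1}tE /node -/N; ring.
  rewrite normrM (gtr0_norm w0) mulrA.
  have -> : al + be * v k = L * w * (d + (k%:R / N - x) ^+ 2 / d).
    by rewrite /al /be /v; field; rewrite !gt_eqF.
  rewrite ler_pM2l ?mulr_gt0//; set u := _ - x; rewrite -(real_normK (num_real u)).
  rewrite -(ler_pM2r d0) mulrDl divfK ?gt_eqF//.
  have := sqr_ge0 (`|u| - d); have := normr_ge0 u; nra.
have bv : (bernstein n.+1 v).[x] <= N.
  rewrite bernstein_variance -/N subrr expr0n addr0 -mulrA ger_pMr//.
  by apply: mulr_ile1; lra.
have up : (bernstein n.+1 (fun k => g (node n.+1 k))).[x] <= g t + al + be * N.
  apply: le_trans (_ : (bernstein n.+1 (fun k => (g t + al) + be * v k)).[x] <= _).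
    by apply: bernstein_le => // k /hv; rewrite ler_norml /= => /andP[]; lra.
  by rewrite bernstein_affine lerD2l ler_wpM2l.
have lo : g t - al - be * N <= (bernstein n.+1 (fun k => g (node n.+1 k))).[x].
  apply: le_trans (_ : _ <= (bernstein n.+1 (fun k => (g t - al) + (- be) * v k)).[x]) _.
    by rewrite bernstein_affine mulNr lerD2l lerN2 ler_wpM2l.
  by apply: bernstein_le => // k /hv; rewrite ler_norml /= mulNr => /andP[]; lra.
have small : al + be * N <= e.
  have eE : e = L * w * (d + d) by rewrite /d; field; rewrite !gt_eqF.
  have -> : al + be * N = L * w * (d + N^-1 / d).
    by rewrite /al /be; field; rewrite !gt_eqF.
  rewrite [leRHS]eE ler_pM2l ?mulr_gt0// lerD2l ler_pdivrMr// -expr2; exact: ltW.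
by rewrite ler_norml; apply/andP; split; lra.
Qed.

(** The sign of r decides which end dominates; the sum of the end values covers both cases. *)
Lemma powR_le_ends a b r x : 0 < a -> a <= x <= b -> x `^ r <= a `^ r + b `^ r.
Proof.
move=> a0 /andP[ax xb]; have x0 : 0 < x by exact: lt_le_trans ax.
have [r0|r0] := leP 0 r.
  apply: le_trans (_ : b `^ r <= _); last by rewrite lerDr powR_ge0.
  by apply: ge0_ler_powR => //; rewrite nnegrE; lra.
apply: le_trans (_ : a `^ r <= _); last by rewrite lerDl powR_ge0.
rewrite -[r]opprK powRN [leRHS]powRN lef_pV2 ?posrE ?powR_gt0//.
by apply: ge0_ler_powR => //; rewrite ?nnegrE; lra.
Qed.

Lemma powR_lipschitz a b r : 0 < a -> lipschitz_seg a b (fun t => t `^ r).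
Proof.
(* The first summand bounds the derivative on [a, b]; the 1 keeps L positive when r = 0. *)
move=> a0; pose L := `|r| * (a `^ (r - 1) + b `^ (r - 1)) + 1.
have L0 : 0 < L by rewrite ltr_wpDl// mulr_ge0// addr_ge0 ?powR_ge0.
exists L => // s t.
wlog st : s t / s <= t => [hw hs ht|/andP[s_ge s_le] /andP[t_ge t_le]].
  have [st|/ltW ts] := leP s t; first exact: hw.
  by rewrite distrC [in leRHS]distrC; exact: hw.
have dr x : 0 < x -> is_derive x 1 (fun t : R => t `^ r) (r * x `^ (r - 1)).
  by move=> x0; exact: is_derive1_powR.
have [||c] := @MVT_segment R (fun t => t `^ r) (fun x => r * x `^ (r - 1)) s t st.
- by move=> x; rewrite in_itv/= => /andP[sx xt]; apply: dr; lra.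
- apply: derivable_within_continuous => x; rewrite in_itv/= => /andP[sx xt].
  by have [|//] := dr x; lra.
rewrite in_itv/= => /andP[sc ct]; rewrite distrC => ->.
rewrite [in leRHS]distrC normrM ler_wpM2r// normrM (ger0_norm (powR_ge0 _ _)).
apply: le_trans (_ : `|r| * (a `^ (r - 1) + b `^ (r - 1)) <= _); last by rewrite lerDl.
by rewrite ler_wpM2l// powR_le_ends//; lra.
Qed.

(** With w the weighted mean, ln z - ln w <= z / w - 1 holds at z = x and z = y; weighted by p and 1
    - p, the right sides add up to 0. *)
Lemma powR_amgm x y p : 0 < x -> 0 < y -> 0 <= p <= 1 ->
  x `^ p * y `^ (1 - p) <= p * x + (1 - p) * y.
Proof.
move=> x0 y0 /andP[p0 p1]; set w := p * x + _.
have w0 : 0 < w.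
  rewrite /w; have [->|pn] := eqVneq p 0; first by rewrite mul0r subr0 mul1r add0r.
  have : 0 < p * x by rewrite mulr_gt0// lt_neqAle eq_sym pn.
  have : 0 <= (1 - p) * y by rewrite mulr_ge0 ?subr_ge0// ltW.
  lra.
have lnw z : 0 < z -> ln z - ln w <= z / w - 1.
  move=> z0; rewrite -ln_div ?posrE//.
  have zw : 0 < z / w by rewrite divr_gt0.
  by rewrite -{1}(subrK 1 (z / w)) [_ + 1]addrC; apply: le_ln1Dx; lra.
rewrite -(ler_ln (x := x `^ p * _)) ?posrE ?mulr_gt0 ?powR_gt0//.
rewrite lnM ?posrE ?powR_gt0// !ln_powR.
have h1 := ler_wpM2l p0 (lnw x x0).
have h2 : (1 - p) * (ln y - ln w) <= (1 - p) * (y / w - 1).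
  by rewrite ler_wpM2l ?subr_ge0//; exact: lnw.
have h3 : p * (x / w - 1) + (1 - p) * (y / w - 1) = 0.
  have -> : p * (x / w - 1) + (1 - p) * (y / w - 1) =
      (p * x + (1 - p) * y) / w - 1 by field; rewrite gt_eqF.
  by rewrite -/w divff ?gt_eqF// subrr.
nra.
Qed.
End scalar.

(** * The chord of a power and the constant delta *)

Section chord.
Context {R : realType}.
Implicit Types (a b c x y s t r p lam m M : R).

Lemma aff_gt0 lam t : 0 <= lam <= 1 -> 0 < t -> 0 < aff lam t.
Proof.
move=> /andP[l0 l1] t0; rewrite /aff; have [->|ln] := eqVneq lam 0.
  by rewrite mul0r; lra.
have : 0 < lam * t by rewrite mulr_gt0// lt_neqAle eq_sym ln.
lra.
Qed.

(** After multiplication by s^(1 - p), AM-GM bounds the terms at a and at b; these are the tangent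
    inequalities at s. Averaged with weights (b - s) / (b - a) and (s - a) / (b - a), their right
    sides give exactly s. *)
Lemma powR_chord a b p s : 0 < a -> a < b -> 0 <= p <= 1 -> a <= s <= b ->
  (b `^ p - a `^ p) / (b - a) * s + (b * a `^ p - a * b `^ p) / (b - a) <= s `^ p.
Proof.
move=> a0 ab p01 /andP[as_ sb].
have b0 : 0 < b by lra. have s0 : 0 < s by lra. have w0 : 0 < b - a by lra.
have ha := powR_amgm a0 s0 p01; have hb := powR_amgm b0 s0 p01.
have sp : 0 < s `^ (1 - p) by rewrite powR_gt0.
have sE : s `^ p * s `^ (1 - p) = s.
  rewrite -powRD; last by apply/implyP => _; rewrite gt_eqF.
  by rewrite addrC subrK powRr1// ltW.
rewrite -(ler_pM2r sp) sE.
have -> : ((b `^ p - a `^ p) / (b - a) * s + (b * a `^ p - a * b `^ p) / (b - a)) * s `^ (1 - p) =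
  ((b - s) * (a `^ p * s `^ (1 - p)) + (s - a) * (b `^ p * s `^ (1 - p))) / (b - a).
  by field; rewrite subr_eq0 gt_eqF.
rewrite ler_pdivrMr//.
have h1 : (b - s) * (a `^ p * s `^ (1 - p)) <= (b - s) * (p * a + (1 - p) * s).
  by rewrite ler_wpM2l// subr_ge0.
have h2 : (s - a) * (b `^ p * s `^ (1 - p)) <= (s - a) * (p * b + (1 - p) * s).
  by rewrite ler_wpM2l// subr_ge0.
apply: le_trans (lerD h1 h2) _; rewrite le_eqVlt; apply/orP; left; apply/eqP; ring.
Qed.

(* delta is the maximum over t of t^p / (al t + be), where al t + be is the
   chord of t^p over [a, b]; for 0 < p < 1 it is attained at the s of the proof,
   p u / (v (1 - p)) with v = b^p - a^p and u = b a^p - a b^p. *)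
Lemma delta_tangent lam p m M : 0 <= p <= 1 -> 0 < lam ->
  let a := aff lam m in let b := aff lam M in 0 < a -> a < b ->
  forall t, 0 < t -> t `^ p <=
    delta lam p m M * ((b `^ p - a `^ p) / (b - a) * t + (b * a `^ p - a * b `^ p) / (b - a)).
Proof.
move=> /andP[p0 p1] lam0 a b a0 ab t t0.
have b0 : 0 < b by lra. have w0 : 0 < b - a by lra.
rewrite /delta (gt_eqF lam0) -/a -/b.
(* At p = 0 and at p = 1 the convention 0^0 = 1 gives [delta] the value 1, and the chord is t^p
   itself, so equality holds. *)
have [->|pn0] := eqVneq p 0.
  rewrite !powRr0 !sub0r !mulr1 !subr0 powR1 powR_inv1 ?(ltW w0)//.
  rewrite le_eqVlt; apply/orP; left; apply/eqP; field; rewrite subr_eq0 gt_eqF//.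
have [->|pn1] := eqVneq p 1.
  rewrite subrr !powRr0 (powRr1 (ltW t0)) (powRr1 (ltW a0)) (powRr1 (ltW b0)).
  rewrite (powRr1 (ltW w0)) (powRr1 ler01).
  rewrite le_eqVlt; apply/orP; left; apply/eqP; field; rewrite subr_eq0 gt_eqF//.
have {pn0}p0 : 0 < p by rewrite lt_neqAle eq_sym pn0.
have {pn1}p1 : p < 1 by rewrite lt_neqAle pn1.
have v0 : 0 < b `^ p - a `^ p.
  by rewrite subr_gt0; apply: gt0_ltr_powR => //; rewrite nnegrE ltW.
have u0 : 0 < b * a `^ p - a * b `^ p.
  have split_ z : 0 < z -> z = z `^ p * z `^ (1 - p).
    move=> z0; rewrite -powRD; last by apply/implyP => _; rewrite gt_eqF.
    by rewrite addrC subrK powRr1// ltW.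
  rewrite {1}(split_ b)// {2}(split_ a)//.
  have -> : b `^ p * b `^ (1 - p) * a `^ p - a `^ p * a `^ (1 - p) * b `^ p =
    a `^ p * b `^ p * (b `^ (1 - p) - a `^ (1 - p)) by ring.
  rewrite !mulr_gt0 ?powR_gt0// subr_gt0.
  by apply: gt0_ltr_powR; rewrite ?nnegrE ?subr_gt0// ltW.
move: (b `^ p - a `^ p) (b * a `^ p - a * b `^ p) v0 u0 => v u v0 u0.
have q0 : 0 < 1 - p by rewrite subr_gt0.
pose s := p * u / (v * (1 - p)).
have s0 : 0 < s by rewrite divr_gt0 ?mulr_gt0.
have p01 : 0 <= p <= 1 by rewrite !ltW.
(* For this s the right side p t + (1 - p) s is (p / v) (v t + u), a multiple of the chord. The
   factor b - a in [delta] will cancel the denominator of the chord. *)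
have := powR_amgm t0 s0 p01.
have sE : s `^ (1 - p) = ((1 - p) `^ (p - 1) * v `^ p) / (p `^ p * u `^ (p - 1)) * (p / v).
  have pE z : 0 < z -> z `^ p = z `^ (p - 1) * z.
    by move=> z0; rewrite mulrC mulr_powRB1// ltW.
  have -> : s `^ (1 - p) = (s `^ (p - 1))^-1 by rewrite -powRN opprB.
  have -> : s `^ (p - 1) = p `^ (p - 1) * u `^ (p - 1) / (v `^ (p - 1) * (1 - p) `^ (p - 1)).
    rewrite /s powRM ?invr_ge0 ?mulr_ge0 ?(ltW p0) ?(ltW q0) ?(ltW u0) ?(ltW v0)//.
    rewrite (powRM _ (ltW p0) (ltW u0)) -(powRM _ (ltW v0) (ltW q0)).
    congr (_ * _).
    have vq : 0 <= v * (1 - p) by rewrite ltW// mulr_gt0.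
    by rewrite -(powR_inv1 vq) powRAC powR_inv1// powR_ge0.
  rewrite (pE p)// (pE v)//.
  have z1 : v `^ (p - 1) != 0 by rewrite gt_eqF ?powR_gt0.
  have z2 : u `^ (p - 1) != 0 by rewrite gt_eqF ?powR_gt0.
  have z3 : p `^ (p - 1) != 0 by rewrite gt_eqF ?powR_gt0.
  have z4 : (1 - p) `^ (p - 1) != 0 by rewrite gt_eqF ?powR_gt0.
  by field; rewrite z1 z2 z3 z4 !gt_eqF.
have -> : p * t + (1 - p) * s = (v * t + u) * (p / v).
  by rewrite /s; field; rewrite !gt_eqF.
rewrite sE mulrA ler_pM2r ?divr_gt0//.
have d1 : 0 < p `^ p * u `^ (p - 1) by rewrite mulr_gt0 ?powR_gt0.
have d2 : 0 < (1 - p) `^ (p - 1) * v `^ p by rewrite mulr_gt0 ?powR_gt0.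
rewrite mulrA ler_pdivrMr// -ler_pdivlMr// => h; apply: le_trans h _.
rewrite le_eqVlt; apply/orP; left; apply/eqP; field.
by rewrite !gt_eqF ?powR_gt0// subr_gt0.
Qed.

Lemma delta_ge0 lam p m M : 0 <= lam -> m <= M -> 0 <= delta lam p m M.
Proof.
move=> l0 mM; rewrite /delta; case: ifP => // _.
rewrite divr_ge0 ?mulr_ge0 ?powR_ge0// /aff.
have : lam * m <= lam * M by rewrite ler_wpM2l.
lra.
Qed.

Lemma delta_chord lam p m M : 0 < m -> m < 1 -> 1 < M -> 0 <= p <= 1 -> 0 <= lam <= 1 ->
  exists al be, [/\ 0 <= al, al * aff lam m + be = aff lam m `^ p,
    forall s, aff lam m <= s <= aff lam M -> al * s + be <= s `^ p &
    forall t, 0 < t -> (lam = 0 -> t <= 1) -> t `^ p <= delta lam p m M * (al * t + be)].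
Proof.
move=> m0 m1 M1 p01 lam01; have [l0|l0] := eqVneq lam 0.
  have aE t : aff lam t = 1 by rewrite /aff l0 subr0 mul0r addr0.
  (* Here f is constantly 1 and the slope of the chord would read 0 / 0; slope 0 and height 1
     replace it, and t^p <= 1 is where t <= 1 enters. *)
  exists 0, 1; split=> //; rewrite ?aE ?mul0r ?add0r ?powR1//.
    by move=> s hs; have -> : s = 1 by [lra]; rewrite mul0r add0r powR1.
  move=> t t0 /(_ l0) t1; rewrite /delta l0 eqxx mul0r add0r mulr1.
  rewrite -(powRr0 t); apply: ger_powR; first by rewrite t0.
  by case/andP: p01.
have lam0 : 0 < lam by case/andP: lam01 => l _; rewrite lt_neqAle eq_sym l0.
have a0 : 0 < aff lam m by exact: aff_gt0.
have ab : aff lam m < aff lam M.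
  have : lam * m < lam * M by rewrite ltr_pM2l//; lra.
  rewrite /aff; lra.
pose a := aff lam m; pose b := aff lam M.
exists ((b `^ p - a `^ p) / (b - a)), ((b * a `^ p - a * b `^ p) / (b - a)); split.
- rewrite divr_ge0//; last by rewrite subr_ge0 ltW.
  rewrite subr_ge0; apply: ge0_ler_powR; rewrite ?nnegrE /a /b; [by case/andP: p01|lra..].
- by rewrite -/a; field; rewrite subr_eq0 gt_eqF.
- by move=> s; exact: powR_chord.
- by move=> t t0 _; exact: delta_tangent.
Qed.
End chord.

(** * The underlying real inner product *)

Section hilbert.
Context {R : realType} {H : hilbertType R}.
Implicit Types (x y z : H) (a b : R).

(** Estimates are carried out in R. The imaginary part of an inner product is recovered by
    [Im_inner], so the real part carries all the information. *)
Definition rinner x y : R := complex.Re (inner x y).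
Definition rnorm x : R := complex.Re `|x|.

Lemma rnormE x : (rnorm x)%:C = `|x|.
Proof. exact: RRe_real (normr_real x). Qed.

Lemma rnorm_ge0 x : 0 <= rnorm x.
Proof. rewrite -lecR rnormE; exact: normr_ge0. Qed.

Lemma rnorm_sq x : rnorm x ^+ 2 = rinner x x.
Proof.
apply: (@complexI R); rewrite rmorphXn/= rnormE -innerxx /rinner RRe_real//.
by rewrite innerxx ger0_real// exprn_ge0.
Qed.

Lemma rnorm_eq0 x : rnorm x = 0 -> x = 0.
Proof. by move=> h; apply/eqP; rewrite -normr_eq0 -rnormE h. Qed.

Lemma rnorm0 : rnorm 0 = 0.
Proof. by rewrite /rnorm normr0. Qed.

Lemma rinnerC x y : rinner x y = rinner y x.
Proof. by rewrite /rinner hermC/= expr0 mul1r; case: (inner y x). Qed.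

Lemma rinnerDl x y z : rinner (x + y) z = rinner x z + rinner y z.
Proof. by rewrite /rinner linearDl raddfD. Qed.

Lemma rinnerZl a x z : rinner (a%:C *: x) z = a * rinner x z.
Proof. by rewrite /rinner linearZl_LR/=; case: (inner x z) => u v /=; rewrite mul0r subr0. Qed.

Lemma rinnerNl x z : rinner (- x) z = - rinner x z.
Proof. by rewrite -scaleN1r -[-1](rmorphN1 (real_complex R)) rinnerZl mulN1r. Qed.

Lemma rinnerDr x y z : rinner z (x + y) = rinner z x + rinner z y.
Proof. by rewrite ![rinner z _]rinnerC rinnerDl. Qed.
Lemma rinnerNr x z : rinner z (- x) = - rinner z x.
Proof. by rewrite ![rinner z _]rinnerC rinnerNl. Qed.
Lemma rinnerZr a x z : rinner z (a%:C *: x) = a * rinner z x.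
Proof. by rewrite ![rinner z _]rinnerC rinnerZl. Qed.
Lemma rinnerBl x y z : rinner (x - y) z = rinner x z - rinner y z.
Proof. by rewrite rinnerDl rinnerNl. Qed.
Lemma rinnerBr x y z : rinner z (x - y) = rinner z x - rinner z y.
Proof. by rewrite rinnerDr rinnerNr. Qed.
Lemma rinner0l x : rinner 0 x = 0.
Proof. by rewrite /rinner linear0l. Qed.

Lemma Im_inner x y : complex.Im (inner x y) = - rinner ('i *: x) y.
Proof.
rewrite /rinner linearZl_LR/=; case: (inner x y) => u v /=.
by rewrite mul0r mul1r sub0r opprK.
Qed.

Lemma rnormZ a x : rnorm (a%:C *: x) = `|a| * rnorm x.
Proof.
apply: (@complexI R).
by rewrite rmorphM/= !rnormE normrZ normc_def/= expr0n addr0 sqrtr_sqr.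
Qed.
Lemma rnormN x : rnorm (- x) = rnorm x.
Proof. by rewrite /rnorm normrN. Qed.
Lemma rnormD x y : rnorm (x + y) <= rnorm x + rnorm y.
Proof. by rewrite -lecR rmorphD/= !rnormE ler_normD. Qed.

(* A nonnegative quadratic t |-> <P(x + ty), x + ty> has nonpositive discriminant. *)
Lemma form_cauchy (P : H -> H) x y : linear P ->
  (forall u v, rinner (P u) v = rinner u (P v)) -> (forall u, 0 <= rinner (P u) u) ->
  rinner (P x) y ^+ 2 <= rinner (P x) x * rinner (P y) y.
Proof.
move=> linP symmP posP.
have q t : 0 <= rinner (P x) x + 2 * t * rinner (P x) y + t ^+ 2 * rinner (P y) y.
  have := posP (t%:C *: y + x).
  rewrite linP !rinnerDl !rinnerDr !rinnerZl !rinnerZr [rinner (P y) x]symmP [rinner y _]rinnerC.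
  by congr (0 <= _); ring.
have c0 := posP y; have a0 := posP x.
have [c_eq|c_ne] := eqVneq (rinner (P y) y) 0.
  have b0 : rinner (P x) y = 0.
    apply/eqP; apply: contraT => bn.
    have := q (- (rinner (P x) x + 1) / (2 * rinner (P x) y)); rewrite c_eq mulr0 addr0.
    rewrite [X in _ + X](_ : _ = - (rinner (P x) x + 1)); last by field.
    lra.
  by rewrite b0 c_eq expr0n mulr0.
have c_gt : 0 < rinner (P y) y by rewrite lt_neqAle eq_sym c_ne.
have := q (- rinner (P x) y / rinner (P y) y).
rewrite [X in 0 <= X](_ : _ =
  (rinner (P x) x * rinner (P y) y - rinner (P x) y ^+ 2) / rinner (P y) y); last by field.
by rewrite pmulr_lge0 ?invr_gt0// subr_ge0.
Qed.

Lemma rinner_cauchy x y : rinner x y <= rnorm x * rnorm y.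
Proof.
have := @form_cauchy id x y _ (fun _ _ => erefl) _.
rewrite -!rnorm_sq -exprMn => h.
have nn : 0 <= rnorm x * rnorm y by rewrite mulr_ge0 ?rnorm_ge0.
apply: le_trans (ler_norm _) _.
rewrite -(ler_pXn2r (n:=2))// ?nnegrE// real_normK ?num_real//.
by apply: h => // u; rewrite -rnorm_sq sqr_ge0.
Qed.

End hilbert.

(** * Bounded operators *)

Section operators.
Context {R : realType} {H : hilbertType R}.
Implicit Types (x y z : H) (a b c : R) (N S T : H -> H).

Definition blin T := linear T /\ exists2 K : R, 0 < K & forall x, rnorm (T x) <= K * rnorm x.

Definition symm T := forall x y, rinner (T x) y = rinner x (T y).

Section linear_fun.
Variables (T : H -> H) (linT : linear T).
Let TL : {linear H -> H} := HB.pack T (GRing.isLinear.Build _ _ _ _ T linT).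
Lemma linD x y : T (x + y) = T x + T y. Proof. exact: (linearD TL). Qed.
Lemma linB x y : T (x - y) = T x - T y. Proof. exact: (linearB TL). Qed.
Lemma linZ (k : R[i]) x : T (k *: x) = k *: T x. Proof. exact: (linearZ_LR TL). Qed.
Lemma lin0 : T 0 = 0. Proof. exact: (linear0 TL). Qed.

Lemma continuous_bounded :
  continuous T <-> exists2 K : R, 0 < K & forall x, rnorm (T x) <= K * rnorm x.
Proof.
have b1 := linear_bounded_continuous TL; have b2 := linear_boundedP TL.
split=> [/b1/b2|[K K0 hK]].
  move=> [M [Mr hM]]; pose k : R := `|complex.Re M| + 1.
  have k0 : 0 < k by rewrite ltr_pwDr.
  exists k => // x; rewrite -lecR rmorphM/= !rnormE; apply: hM.
  rewrite -(RRe_real Mr) ltcR; apply: le_lt_trans (ler_norm _) _.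
  by rewrite ltrDl.
apply/b1/b2; exists K%:C; split; first by apply/complex_realP; exists K.
move=> r Kr x; apply: le_trans (_ : K%:C * `|x| <= _).
  by rewrite -!rnormE -rmorphM lecR.
by rewrite ler_wpM2r// ltW.
Qed.
End linear_fun.

Lemma blinP T : bounded_op T <-> blin T.
Proof. by split=> -[l] /(continuous_bounded l). Qed.

Lemma opsubE T S x : (T - S) x = T x - S x. Proof. by []. Qed.
Lemma opaddE T S x : (T + S) x = T x + S x. Proof. by []. Qed.
Lemma opscaleE (k : R[i]) T x : (k *: T) x = k *: T x. Proof. by []. Qed.

Lemma blin_scale (k : R[i]) T : blin T -> blin (k *: T).
Proof.
move=> [lT [K K0 hK]]; split.
  by move=> a x y; rewrite !opscaleE lT scalerDr !scalerA mulrC.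
have kE : (complex.Re `|k|)%:C = `|k| := RRe_real (normr_real k).
have k0 : 0 <= complex.Re `|k| by rewrite -lecR kE; exact: normr_ge0.
exists ((complex.Re `|k| + 1) * K); first by rewrite mulr_gt0// ltr_wpDl.
move=> x; rewrite -lecR rnormE opscaleE normrZ.
rewrite -kE -rnormE -rmorphM lecR -mulrA.
by apply: ler_pM; rewrite ?rnorm_ge0 ?lerDl.
Qed.

Lemma blin_id : blin (idfun : H -> H).
Proof. by split=> //; exists 1 => // x; rewrite mul1r. Qed.

Lemma blin_comp S T : blin S -> blin T -> blin (S \o T).
Proof.
move=> [lS [K K0 hK]] [lT [L L0 hL]]; split.
  by move=> a x y /=; rewrite lT lS.
exists (K * L); first exact: mulr_gt0.
by move=> x /=; apply: le_trans (hK _) _; rewrite -mulrA ler_pM2l.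
Qed.

Lemma blin_add S T : blin S -> blin T -> blin (S + T).
Proof.
move=> [lS [K K0 hK]] [lT [L L0 hL]]; split.
  by move=> a x y; rewrite !opaddE lT lS scalerDr addrACA.
exists (K + L); first exact: addr_gt0.
by move=> x; apply: le_trans (rnormD _ _) _; rewrite mulrDl lerD.
Qed.

Lemma blin_sub S T : blin S -> blin T -> blin (S - T).
Proof.
by move=> bS bT; rewrite -[- T]scaleN1r; apply: blin_add => //; exact: blin_scale.
Qed.

Lemma blin_sum n (F : 'I_n -> H -> H) : (forall j, blin (F j)) -> blin (\sum_j F j).
Proof.
move=> h; elim/big_ind : _ => //; last exact: blin_add.
by rewrite -(scale0r (idfun : H -> H)); apply: blin_scale; exact: blin_id.
Qed.

Lemma symm_add S T : symm S -> symm T -> symm (S + T).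
Proof. by move=> hS hT x y; rewrite !opaddE rinnerDl rinnerDr hS hT. Qed.
Lemma symm_scale a T : symm T -> symm (a%:C *: T).
Proof. by move=> hT x y; rewrite !opscaleE rinnerZl rinnerZr hT. Qed.
Lemma symm_sub S T : symm S -> symm T -> symm (S - T).
Proof. by move=> hS hT x y; rewrite !opsubE rinnerBl rinnerBr hS hT. Qed.

Lemma symmP T : linear T -> selfadjoint T <-> symm T.
Proof.
move=> lT; split=> h x y; first by rewrite /rinner h.
apply/eqP; rewrite eq_complex; apply/andP; split; apply/eqP; first exact: h.
by rewrite !Im_inner -h (linZ lT).
Qed.

Lemma op_ge0_rinner T : op_ge0 T -> forall x, 0 <= rinner (T x) x.
Proof. by move=> h x; have := h x; rewrite lecE => /andP[]. Qed.

(** Sesquilinearity makes the left side the opposite of Re <T x, i x>, while symmetry makes it equal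
    to Re <T x, i x>. *)
Lemma rinner_i_symm T x : linear T -> symm T -> rinner ('i *: T x) x = 0.
Proof.
move=> lT saT.
have e : rinner ('i *: T x) x = - rinner (T x) ('i *: x).
  rewrite /rinner linearZl_LR linearZr_LR/=; case: (inner (T x) x) => u v /=.
  lra.
have := e; rewrite -(linZ lT) saT [rinner _ (T x)]rinnerC; lra.
Qed.

(** Nonnegativity in R[i] includes being real; symmetry supplies the vanishing imaginary part. *)
Lemma rinner_op_ge0 T : linear T -> symm T -> (forall x, 0 <= rinner (T x) x) -> op_ge0 T.
Proof.
move=> lT saT h x; rewrite lecE; apply/andP; split; last exact: h.
by rewrite /= Im_inner rinner_i_symm// oppr0.
Qed.

Lemma complete_seq (u : nat -> H) :
  (forall e : R, 0 < e -> exists n0, forall n m, (n0 <= n)%N -> (n0 <= m)%N ->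
     rnorm (u n - u m) <= e) ->
  exists l, forall e : R, 0 < e -> exists n0, forall n, (n0 <= n)%N ->
     rnorm (u n - l) <= e.
Proof.
have toR (e : R[i]) : 0 < e -> exists2 r : R, 0 < r & r%:C < e.
  rewrite ltcE/= => /andP[/eqP i0 r0]; exists (complex.Re e / 2); first by lra.
  rewrite ltcE/= -i0 eqxx/=; lra.
move=> cu.
have cv : cvgn u.
  apply/cauchy_cvgP/cauchy_exP => e /toR[r r0 re].
  have [n0 hn] := cu _ r0.
  exists (u n0); exists n0 => // n /= nn.
  by rewrite -ball_normE/=; apply: le_lt_trans re; rewrite -rnormE lecR; exact: hn.
exists (limn u) => e e0.
move/cvgrPdist_le: cv => /(_ e%:C); rewrite ltcR => /(_ e0)[n0 _ h].
by exists n0 => n hn; rewrite -lecR rnormE distrC; exact: h.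
Qed.

(** The lower bound gives injectivity and bounds the inverse by 1 / c. *)
Lemma invertible_bij N c : blin N -> 0 < c -> (forall x, c * rnorm x <= rnorm (N x)) ->
  (forall y, exists x, N x = y) -> op_invertible N.
Proof.
move=> [lN _] c0 lo /choice[S hS].
have inj x y : N x = N y -> x = y.
  move=> e; apply/eqP; rewrite -subr_eq0; apply/eqP/rnorm_eq0.
  have := lo (x - y); rewrite (linB lN) e subrr rnorm0 pmulr_rle0// => h.
  by apply/le_anti; rewrite h rnorm_ge0.
exists S; split; last by apply/funext => x /=; exact: hS.
  apply/blinP; split; first by move=> a x y; apply: inj; rewrite lN !hS.
  exists c^-1; first by rewrite invr_gt0.
  by move=> x; rewrite ler_pdivlMl// -{2}(hS x).
by apply/funext => x /=; apply: inj; rewrite hS.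
Qed.

End operators.

(** * Invertibility and the spectrum *)

Section spectral.
Context {R : realType} {H : hilbertType R}.
Implicit Types (x y z : H) (a b c : R) (N S T : H -> H).

(* Lax-Milgram: N x = y is the fixed-point equation of the contraction
   x |-> x - t (N x - y) for t = c / K^2. *)
Lemma coercive_invertible N c : blin N -> 0 < c ->
  (forall x, c * rnorm x ^+ 2 <= rinner (N x) x) -> op_invertible N.
Proof.
move=> bN c0 lo; have [lN [K0 K0_gt hK0]] := bN.
have low x : c * rnorm x <= rnorm (N x).
  have [->|x0] := eqVneq x 0; first by rewrite (lin0 lN) rnorm0 mulr0.
  have nx : 0 < rnorm x.
    rewrite lt_neqAle rnorm_ge0 andbT eq_sym.
    by apply: contra x0 => /eqP/rnorm_eq0 ->.
  rewrite -(ler_pM2r nx); apply: le_trans (rinner_cauchy _ _).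
  by rewrite -mulrA -expr2.
apply: (invertible_bij bN c0 low) => y.
(* Enlarging K0 ensures c <= K, hence s >= 0 below. *)
pose K := K0 + c; have K_gt : 0 < K by rewrite addr_gt0.
have hK x : rnorm (N x) <= K * rnorm x.
  by apply: le_trans (hK0 x) _; rewrite ler_wpM2r ?rnorm_ge0// lerDl ltW.
pose t := c / K ^+ 2; have t0 : 0 < t by rewrite divr_gt0// exprn_gt0.
(* Expanding the square gives |x - t N x|^2 <= (1 - 2 t c + t^2 K^2) |x|^2; the chosen t minimizes
   this factor, and s is its value. *)
pose s := 1 - c ^+ 2 / K ^+ 2.
have s01 : 0 <= s < 1.
  rewrite subr_ge0 ler_pdivrMr ?exprn_gt0// mul1r ltrBlDr ltrDl divr_gt0 ?exprn_gt0// andbT.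
  by rewrite ler_pXn2r ?nnegrE ?ltW// ltrDr.
pose k := Num.sqrt s.
have k0 : 0 <= k := sqrtr_ge0 s.
have k1 : k < 1 by rewrite -sqrtr1 ltr_sqrt//; case/andP: s01.
pose L x := x - t%:C *: N x.
have hL x : rnorm (L x) <= k * rnorm x.
  rewrite -(ler_pXn2r (n:=2))// ?nnegrE ?mulr_ge0 ?rnorm_ge0//.
  rewrite exprMn sqr_sqrtr; last by case/andP: s01.
  have -> : rnorm (L x) ^+ 2 = rnorm x ^+ 2 - 2 * t * rinner (N x) x + t ^+ 2 * rnorm (N x) ^+ 2.
    by rewrite !rnorm_sq /L !(rinnerBl, rinnerBr, rinnerZl, rinnerZr) [rinner x (N x)]rinnerC; ring.
  have h1 := lo x.
  have h2 : rnorm (N x) ^+ 2 <= K ^+ 2 * rnorm x ^+ 2.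
    by rewrite -exprMn ler_pXn2r ?nnegrE ?mulr_ge0 ?rnorm_ge0// ltW.
  have h3 : 2 * t * (c * rnorm x ^+ 2) <= 2 * t * rinner (N x) x.
    by rewrite ler_wpM2l// mulr_ge0// ltW.
  have h4 : t ^+ 2 * rnorm (N x) ^+ 2 <= t ^+ 2 * (K ^+ 2 * rnorm x ^+ 2).
    by rewrite ler_wpM2l// sqr_ge0.
  have -> : s * rnorm x ^+ 2 =
      rnorm x ^+ 2 - 2 * t * (c * rnorm x ^+ 2) + t ^+ 2 * (K ^+ 2 * rnorm x ^+ 2).
    by rewrite /s /t; field; rewrite gt_eqF.
  lra.
have LB u v : L u - L v = L (u - v).
  by rewrite /L (linB lN) scalerBr !opprD !opprK addrACA.
pose G x := L x + t%:C *: y.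
have GB u v : rnorm (G u - G v) <= k * rnorm (u - v).
  by rewrite /G opprD addrACA subrr addr0 LB.
pose u n := iter n G 0.
(* M solves M = k M + |G 0|, so it bounds the whole orbit of 0; hence |u (n + m) - u n| <= k^n |u m|
   <= k^n M. *)
pose M := rnorm (G 0) / (1 - k).
have M0 : 0 <= M by rewrite divr_ge0 ?rnorm_ge0// subr_ge0 ltW.
have uM n : rnorm (u n) <= M.
  elim: n => [|n IH]; first by rewrite /u/= rnorm0.
  have -> : u n.+1 = (G (u n) - G 0) + G 0 by rewrite subrK.
  apply: le_trans (rnormD _ _) _.
  have := GB (u n) 0; rewrite subr0 => h1.
  have h2 := ler_wpM2l k0 IH.
  have : rnorm (G 0) = M * (1 - k) by rewrite divfK// subr_eq0 gt_eqF.
  lra.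
have uC n m : rnorm (u (n + m)%N - u n) <= k ^+ n * M.
  elim: n => [|n IH]; first by rewrite add0n expr0 mul1r subr0.
  rewrite addSn exprS -mulrA; apply: le_trans (GB _ _) _.
  by rewrite ler_wpM2l.
have kn e : 0 < e -> exists n0, forall n, (n0 <= n)%N -> k ^+ n * M <= e.
  move=> e0.
  have /cvgrPdist_le/(_ (e / (M + 1))) : (fun n => k ^+ n) @ \oo --> 0.
    by apply: cvg_expr; rewrite ger0_norm.
  case=> [|n0 _ hn]; first by rewrite divr_gt0// ltr_wpDl.
  exists n0 => n /hn/=; rewrite sub0r normrN ger0_norm ?exprn_ge0//.
  rewrite ler_pdivlMr ?ltr_wpDl// => h; apply: le_trans h.
  by rewrite ler_wpM2l ?exprn_ge0// lerDl.
have [|l hl] := complete_seq (u := u).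
  move=> e e0; have [|n0 hn] := kn (e / 2); first by rewrite divr_gt0.
  exists n0 => n m h1 h2.
  have -> : u n - u m = (u n - u n0) + - (u m - u n0) by rewrite opprB addrA subrK.
  apply: le_trans (rnormD _ _) _; rewrite rnormN.
  have := uC n0 (n - n0)%N; have := uC n0 (m - n0)%N; rewrite !subnKC//.
  have := hn n0 (leqnn _); lra.
exists l.
have Gl : G l - l = 0.
  apply/rnorm_eq0/le_anti; rewrite rnorm_ge0 andbT.
  apply/ler_addgt0Pl => e e0; rewrite addr0.
  have [|n0 hn] := hl (e / 2); first by rewrite divr_gt0.
  have h1 := hn n0 (leqnn _); have h2 := hn n0.+1 (leqnSn _).
  have -> : G l - l = - (G (u n0) - G l) + (u n0.+1 - l) by rewrite opprB addrA subrK.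
  apply: le_trans (rnormD _ _) _; rewrite rnormN.
  have := GB (u n0) l; have : k * rnorm (u n0 - l) <= 1 * rnorm (u n0 - l).
    by rewrite ler_wpM2r ?rnorm_ge0// ltW.
  lra.
apply/eqP; rewrite -subr_eq0; apply/eqP.
have : t%:C *: (N l - y) = 0.
  rewrite scalerBr -[RHS]oppr0 -[in RHS]Gl /G /L.
  by rewrite addrAC [_ - _ - l]addrAC subrr add0r opprD opprK.
move/(congr1 (fun v => rnorm v)); rewrite rnormZ rnorm0 => /eqP.
rewrite mulf_eq0 normr_eq0 gt_eqF//= => /eqP/rnorm_eq0 ->//.
Qed.

Lemma op_invertible_scale (k : R[i]) N : k != 0 -> op_invertible (k *: N) -> op_invertible N.
Proof.
move=> k0 [S [/blinP bS h1 h2]]; exists (k *: S); split.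
- by apply/blinP; exact: blin_scale.
- have lS := bS.1; apply/funext => x /=.
  by have := congr1 (fun f => f x) h1; rewrite /= !opscaleE (linZ lS) => ->.
apply/funext => x /=; have [lS _] := bS; have := congr1 (fun f => f (k *: x)) h2.
by rewrite /= (linZ lS) opscaleE opscaleE => /(scalerI k0).
Qed.

Lemma op_invertible_comp S T : op_invertible S -> op_invertible T -> op_invertible (S \o T).
Proof.
move=> [S' [/blinP bS' s1 s2]] [T' [/blinP bT' t1 t2]]; exists (T' \o S'); split.
- by apply/blinP; exact: blin_comp.
- apply/funext => x /=; rewrite -[S' _]/((S' \o S) (T x)) s1.
  by rewrite -[LHS]/((T' \o T) x) t1.
- apply/funext => x /=; rewrite -[T _]/((T \o T') (S' x)) t2.
  by rewrite -[LHS]/((S \o S') x) s2.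
Qed.

Lemma op_invertible_lower N : op_invertible N ->
  exists2 c : R, 0 < c & forall x, c * rnorm x <= rnorm (N x).
Proof.
move=> [S [/blinP[lS [K K0 hK]] h _]]; exists K^-1; first by rewrite invr_gt0.
move=> x; rewrite ler_pdivrMl//.
by have := hK (N x); rewrite -[S (N x)]/((S \o N) x) h.
Qed.

(** Cauchy-Schwarz for the form of N, at x and N x, gives |N x|^4 <= <N x, x> K |N x|^2, so |N x|^2
    <= K <N x, x>; invertibility bounds |N x| below by c |x|. *)
Lemma symm_ge0_coercive N : blin N -> symm N -> (forall x, 0 <= rinner (N x) x) ->
  op_invertible N -> exists2 c : R, 0 < c & forall x, c * rnorm x ^+ 2 <= rinner (N x) x.
Proof.
move=> [lN [K K0 hK]] sN pN /op_invertible_lower[c c0 hc].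
exists (c ^+ 2 / K); first by rewrite divr_gt0 ?exprn_gt0.
move=> x; rewrite mulrAC ler_pdivrMr//.
have h1 : (c * rnorm x) ^+ 2 <= rnorm (N x) ^+ 2.
  by rewrite ler_pXn2r ?nnegrE ?mulr_ge0 ?rnorm_ge0// ltW.
rewrite -exprMn; apply: le_trans h1 _.
have h2 := form_cauchy x (N x) lN sN pN.
have h3 : rinner (N (N x)) (N x) <= K * rnorm (N x) ^+ 2.
  apply: le_trans (rinner_cauchy _ _) _.
  by rewrite expr2 mulrA ler_wpM2r ?rnorm_ge0.
have [n0|n0] := eqVneq (rnorm (N x)) 0; first by rewrite n0 expr0n/= mulr_ge0 ?pN// ltW.
have n1 : 0 < rnorm (N x) ^+ 2 by rewrite exprn_even_gt0.
rewrite -(ler_pM2r n1); rewrite -rnorm_sq -expr2 in h2 *.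
apply: le_trans h2 _; rewrite -mulrA; exact: ler_wpM2l.
Qed.

(** Take the largest lower bound a of the form. If T - a were invertible it would be coercive with
    some c > 0, and a + c would still be a lower bound. The nonzero vector makes the set of lower
    bounds bounded above. *)
Lemma inf_form_spectrum T (x0 : H) : blin T -> symm T -> x0 != 0 ->
  exists2 a : R, (forall x, a * rnorm x ^+ 2 <= rinner (T x) x) & spectrum T a%:C.
Proof.
move=> bT sT x00; have [lT [K K0 hK]] := bT.
have nx0 : 0 < rnorm x0.
  rewrite lt_neqAle rnorm_ge0 andbT eq_sym.
  by apply: contra x00 => /eqP/rnorm_eq0 ->.
pose E := [set a : R | forall x, a * rnorm x ^+ 2 <= rinner (T x) x].
have E0 : E !=set0.
  exists (- K) => x; have := rinner_cauchy (- T x) x; rewrite rinnerNl rnormN.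
  have : rnorm (T x) * rnorm x <= K * rnorm x ^+ 2 by rewrite expr2 mulrA ler_wpM2r ?rnorm_ge0.
  lra.
have Eb : has_ubound E.
  exists (rinner (T x0) x0 / rnorm x0 ^+ 2) => a /(_ x0).
  by rewrite ler_pdivlMr// exprn_gt0.
have hs : E (sup E).
  move=> x; have [xn|xn] := eqVneq (rnorm x) 0.
    by rewrite (rnorm_eq0 xn) rnorm0 expr0n mulr0 (lin0 lT) rinner0l.
  have n1 : 0 < rnorm x ^+ 2 by rewrite exprn_even_gt0.
  rewrite -ler_pdivlMr//; apply: ge_sup => // a /(_ x).
  by rewrite ler_pdivlMr.
exists (sup E) => // inv.
pose N := T - (sup E)%:C *: (idfun : H -> H).
have [||x|c c0 hc] := @symm_ge0_coercive N _ _ _ inv.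
- by apply: blin_sub => //; apply: blin_scale; exact: blin_id.
- by apply: symm_sub => //; apply: symm_scale.
- by rewrite /N opsubE opscaleE rinnerBl rinnerZl -rnorm_sq subr_ge0; exact: hs.
have : E (sup E + c).
  move=> x; have := hc x.
  by rewrite /N opsubE opscaleE rinnerBl rinnerZl -rnorm_sq lerBrDl mulrDl.
move/(ub_le_sup Eb); lra.
Qed.

(** If w has imaginary part b != 0, multiplying T - w by i or -i, according to the sign of b, gives
    the real form |b| |x|^2, which is coercive. *)
Lemma spectrum_real T (w : R[i]) : blin T -> symm T -> spectrum T w -> w = (complex.Re w)%:C.
Proof.
move=> bT sT; have [lT _] := bT; case: w => a b h /=.
have [->//|b0] := eqVneq b 0; exfalso; apply: h.
pose k : R[i] := (if 0 < b then 1 else -1)%:C * 'i.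
have k0 : k != 0.
  by rewrite mulf_neq0 ?neq0Ci// (inj_eq (@complexI R) _ 0); case: ifP; lra.
apply: (op_invertible_scale k0).
apply: (@coercive_invertible _ `|b|); first 2 last.
- move=> x; rewrite opscaleE opsubE opscaleE -scalerA scalerBr scalerA.
  have -> : 'i * (a +i* b) = (- b)%:C + a%:C * 'i :> R[i].
    by apply/eqP; rewrite eq_complex/=; apply/andP; split; apply/eqP; ring.
  rewrite scalerDl -[(a%:C * 'i) *: _]scalerA rinnerZl rinnerBl rinnerDl !rinnerZl.
  rewrite (rinner_i_symm _ lT sT) (@rinner_i_symm _ _ id)// -rnorm_sq.
  by case: ltrgtP b0 => // b0 _; rewrite [X in _ <= X](_ : _ = `|b| * rnorm x ^+ 2)//;
    rewrite ?(gtr0_norm b0) ?(ltr0_norm b0); ring.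
- by apply: blin_scale; apply: blin_sub => //; apply: blin_scale; exact: blin_id.
- by rewrite normr_gt0.
Qed.

Lemma spectrum_ge T c t : blin T -> symm T -> (forall x, c * rnorm x ^+ 2 <= rinner (T x) x) ->
  spectrum T t%:C -> c <= t.
Proof.
move=> bT sT hc; apply: contra_notT; rewrite -ltNge => tc.
apply: (@coercive_invertible _ (c - t)); last 1 first.
- by move=> x; rewrite opsubE opscaleE rinnerBl rinnerZl -rnorm_sq mulrBl lerB.
- by apply: blin_sub => //; apply: blin_scale; exact: blin_id.
- by rewrite subr_gt0.
Qed.

Lemma spectrum_le T c t : blin T -> symm T -> (forall x, rinner (T x) x <= c * rnorm x ^+ 2) ->
  spectrum T t%:C -> t <= c.
Proof.
move=> bT sT hc; apply: contra_notT; rewrite -ltNge => tc.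
apply: (@op_invertible_scale (-1)); first by rewrite oppr_eq0 oner_eq0.
apply: (@coercive_invertible _ (t - c)); last 1 first.
- move=> x; rewrite opscaleE scaleN1r opsubE opscaleE.
  rewrite rinnerNl rinnerBl rinnerZl -rnorm_sq opprB mulrBl.
  by rewrite lerB.
- by apply: blin_scale; apply: blin_sub => //; apply: blin_scale; exact: blin_id.
- by rewrite subr_gt0.
Qed.
End spectral.

(** * Polynomials of an operator *)

Section polynomials.
Context {R : realType} {H : hilbertType R}.
Implicit Types (x y z : H) (a b c : R) (N S T : H -> H) (p q : {poly R[i]}).

(** Complex coefficients allow a splitting into linear factors; [poly_opE] transfers results to
    [poly_op]. *)
Definition cpoly_op (p : {poly R[i]}) T x : H := \sum_(k < size p) p`_k *: iter k T x.

Lemma cpoly_op_widen p T x n : (size p <= n)%N -> cpoly_op p T x = \sum_(k < n) p`_k *: iter k T x.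
Proof.
move=> pn; rewrite /cpoly_op (big_ord_widen n (fun k => p`_k *: iter k T x))// big_mkcond.
apply: eq_bigr => k _; case: ltnP => // sk.
by rewrite nth_default ?scale0r.
Qed.

Lemma cpoly_opD p q T x : cpoly_op (p + q) T x = cpoly_op p T x + cpoly_op q T x.
Proof.
pose n := maxn (size p) (size q).
rewrite !(@cpoly_op_widen _ _ _ n) ?leq_maxl ?leq_maxr ?size_polyD//.
by rewrite -big_split; apply: eq_bigr => k _; rewrite coefD scalerDl.
Qed.

Lemma cpoly_opZ (k : R[i]) p T x : cpoly_op (k *: p) T x = k *: cpoly_op p T x.
Proof.
rewrite (@cpoly_op_widen _ _ _ (size p)) ?size_scale_leq// /cpoly_op scaler_sumr.
by apply: eq_bigr => i _; rewrite coefZ scalerA.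
Qed.

Lemma cpoly_opC (k : R[i]) T x : cpoly_op k%:P T x = k *: x.
Proof.
by rewrite (@cpoly_op_widen _ _ _ 1) ?size_polyC ?leq_b1// big_ord1 coefC.
Qed.

Lemma cpoly_opMX p T x : cpoly_op (p * 'X) T x = cpoly_op p T (T x).
Proof.
rewrite (@cpoly_op_widen _ _ _ (size p).+1); last first.
  by have := size_polyMleq p 'X; rewrite size_polyX addn2.
rewrite big_ord_recl coefMX eqxx scale0r add0r.
by apply: eq_bigr => i _; rewrite coefMX /= -iterSr.
Qed.

Lemma cpoly_op_comm p T x : linear T -> T (cpoly_op p T x) = cpoly_op p T (T x).
Proof.
move=> lT; elim/poly_ind: p x => [|p k IH] x.
  by rewrite /cpoly_op size_poly0 !big_ord0 (lin0 lT).
by rewrite !cpoly_opD !cpoly_opMX !cpoly_opC (linD lT) (linZ lT) IH.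
Qed.

Lemma cpoly_op_blin p T : blin T -> blin (cpoly_op p T).
Proof.
move=> bT; elim/poly_ind: p => [|p k IH].
  have -> : cpoly_op 0 T = 0 *: (idfun : H -> H).
    by apply/funext => x; rewrite -polyC0 cpoly_opC.
  by apply: blin_scale; exact: blin_id.
have -> : cpoly_op (p * 'X + k%:P) T = (cpoly_op p T \o T) + k *: (idfun : H -> H).
  by apply/funext => x; rewrite cpoly_opD cpoly_opMX cpoly_opC.
by apply: blin_add; [exact: blin_comp | apply: blin_scale; exact: blin_id].
Qed.

Lemma cpoly_opM p q T x : blin T -> cpoly_op (p * q) T x = cpoly_op p T (cpoly_op q T x).
Proof.
move=> bT; have lT := bT.1; elim/poly_ind: p x => [|p k IH] x.
  by rewrite mul0r -polyC0 !cpoly_opC !scale0r.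
rewrite mulrDl cpoly_opD mulrAC cpoly_opMX IH mul_polyC cpoly_opZ cpoly_opD cpoly_opMX cpoly_opC.
by rewrite cpoly_op_comm.
Qed.

(** The polynomial splits, so its value at T is a nonzero scalar times a composition of operators T
    - w over the roots w, each invertible. *)
Lemma cpoly_op_invertible p T : blin T -> p != 0 ->
  (forall w, root p w -> ~ spectrum T w) -> op_invertible (cpoly_op p T).
Proof.
move=> bT; have [r pE] := closed_field_poly_normal p.
rewrite -lead_coef_eq0; move: (lead_coef p) pE => l pE l0.
rewrite {}pE => {p} hp.
have {hp} : forall w, w \in r -> ~ spectrum T w.
  by move=> w wr; apply: hp; rewrite rootZ// root_prod_XsubC.
have -> s : cpoly_op (l *: s) T = l *: cpoly_op s T by apply/funext => x; rewrite cpoly_opZ.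
have il : op_invertible (l *: (idfun : H -> H)).
  exists (l^-1 *: idfun); split.
  - by apply/blinP; apply: blin_scale; exact: blin_id.
  - by apply/funext => x; rewrite /= !opscaleE scalerA mulVf// scale1r.
  - by apply/funext => x; rewrite /= !opscaleE scalerA divff// scale1r.
move=> hr.
suff {il} : op_invertible (cpoly_op (\prod_(z <- r) ('X - z%:P)) T).
  move=> h.
  exact: (op_invertible_comp il h).
elim: r hr {l l0} => [|w r IH] hr.
  rewrite big_nil; exists idfun; split.
  - by apply/blinP; exact: blin_id.
  - by apply/funext => x /=; rewrite cpoly_opC scale1r.
  - by apply/funext => x /=; rewrite cpoly_opC scale1r.
rewrite big_cons.
have -> : cpoly_op (('X - w%:P) * \prod_(z <- r) ('X - z%:P)) T =
    (T - w *: (idfun : H -> H)) \o cpoly_op (\prod_(z <- r) ('X - z%:P)) T.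
  apply/funext => x; rewrite cpoly_opM//= opsubE opscaleE.
  by rewrite -(mul1r 'X) -polyCN cpoly_opD cpoly_opMX !cpoly_opC scale1r scaleNr.
apply: op_invertible_comp; last first.
  by apply: IH => v vr; apply: hr; rewrite inE vr orbT.
by apply: contrapT; apply: hr; rewrite inE eqxx.
Qed.

Lemma poly_opE (q : {poly R}) T x : poly_op q T x = cpoly_op (map_poly (real_complex R) q) T x.
Proof.
rewrite /poly_op /cpoly_op fct_sumE size_map_inj_poly//; last exact: (@complexI R).
by apply: eq_bigr => k _; rewrite coef_map.
Qed.

Lemma poly_op_blin (q : {poly R}) T : blin T -> blin (poly_op q T).
Proof. by rewrite (funext (poly_opE q T)); exact: cpoly_op_blin. Qed.

Lemma poly_opD (p q : {poly R}) T x : poly_op (p + q) T x = poly_op p T x + poly_op q T x.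
Proof. by rewrite !poly_opE rmorphD cpoly_opD. Qed.

Lemma poly_opC a T x : poly_op a%:P T x = a%:C *: x.
Proof. by rewrite !poly_opE map_polyC cpoly_opC. Qed.

Lemma poly_opMX (p : {poly R}) T x : poly_op (p * 'X) T x = poly_op p T (T x).
Proof. by rewrite !poly_opE rmorphM/= map_polyX cpoly_opMX. Qed.

Lemma poly_opM (p q : {poly R}) T x : blin T -> poly_op (p * q) T x = poly_op p T (poly_op q T x).
Proof. by move=> bT; rewrite !poly_opE rmorphM/= cpoly_opM. Qed.

Lemma poly_opN (p : {poly R}) T x : poly_op (- p) T x = - poly_op p T x.
Proof. by rewrite !poly_opE rmorphN/= -scaleN1r cpoly_opZ scaleN1r. Qed.

Lemma poly_opB (p q : {poly R}) T x : poly_op (p - q) T x = poly_op p T x - poly_op q T x.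
Proof. by rewrite poly_opD poly_opN. Qed.

Lemma poly_op_symm (q : {poly R}) T : blin T -> symm T -> symm (poly_op q T).
Proof.
move=> bT sT; elim/poly_ind: q => [|q c IH] x y.
  by rewrite -polyC0 !poly_opC rinnerZl rinnerZr.
rewrite !poly_opD !poly_opMX !poly_opC rinnerDl rinnerDr rinnerZl rinnerZr IH sT.
by rewrite !poly_opE (cpoly_op_comm _ _ bT.1).
Qed.

(* The infimum a of the form of q(T) lies in the spectrum of q(T); factoring
   q - a into linear factors over C then puts a root of q - a in the spectrum
   of T, so that a is a value of q there. *)
Lemma spectral_ge0 (q : {poly R}) T : blin T -> symm T ->
  (forall t, spectrum T t%:C -> 0 <= q.[t]) -> forall x, 0 <= rinner (poly_op q T x) x.
Proof.
move=> bT sT hq x; rewrite leNgt; apply/negP => neg.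
have x0 : x != 0.
  by apply: contraTneq neg => ->; rewrite (lin0 (poly_op_blin q bT).1) rinner0l ltxx.
have [a ha spa] := inf_form_spectrum (poly_op_blin q bT) (poly_op_symm q bT sT) x0.
have a0 : a < 0.
  rewrite ltNge; apply/negP => a0; have := ha x.
  have : 0 <= a * rnorm x ^+ 2 by rewrite mulr_ge0// sqr_ge0.
  lra.
have qE : poly_op q T - a%:C *: (idfun : H -> H) =
    cpoly_op (map_poly (real_complex R) (q - a%:P)) T.
  by apply/funext => y; rewrite -poly_opE poly_opB poly_opC.
move: spa; rewrite /spectrum/= qE; apply.
apply: cpoly_op_invertible => //.
  (* If q were the constant a, then a point of the spectrum of T, which exists because x is nonzero,
     would give a >= 0. *)
  rewrite map_poly_eq0; apply/eqP => /subr0_eq qa.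
  have [t _ /hq] := inf_form_spectrum bT sT x0.
  by rewrite qa hornerC leNgt a0.
move=> w /[swap] sw.
move: (complex.Re w) (spectrum_real bT sT sw) => t wt; rewrite {w}wt in sw *.
have := hq _ sw; rewrite /root horner_map/= hornerD hornerN hornerC => h.
by apply/negP; rewrite (inj_eq (@complexI R) _ 0); lra.
Qed.

(* Positivity applied to e^2 - q^2. *)
Lemma spectral_norm (q : {poly R}) T e : blin T -> symm T -> 0 <= e ->
  (forall t, spectrum T t%:C -> `|q.[t]| <= e) -> forall x, rnorm (poly_op q T x) <= e * rnorm x.
Proof.
move=> bT sT e0 hq x.
have := @spectral_ge0 ((e ^+ 2)%:P - q * q) T bT sT _ x.
rewrite poly_opB poly_opC poly_opM// rinnerBl rinnerZl -!rnorm_sq.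
rewrite (poly_op_symm q bT sT) -rnorm_sq subr_ge0 => h.
rewrite -(ler_pXn2r (n:=2))// ?nnegrE ?mulr_ge0 ?rnorm_ge0// exprMn; apply: h => t /hq.
rewrite hornerD hornerC hornerN hornerM subr_ge0 -expr2 -(real_normK (num_real _)) => h.
by rewrite ler_pXn2r ?nnegrE.
Qed.

End polynomials.

(** * Continuous functional calculus *)

Section calculus.
Context {R : realType} {H : hilbertType R}.
Implicit Types (x y z : H) (a b c : R) (S T : H -> H) (g h : R -> R).

Lemma rnormZ_le (k : R[i]) x : rnorm (k *: x) <= (complex.Re `|k|) * rnorm x.
Proof. by rewrite -lecR rmorphM/= !rnormE (RRe_real (normr_real k)) normrZ. Qed.

Lemma le0_small a c : (forall e : R, 0 < e -> a <= e * c) -> a <= 0.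
Proof.
move=> h; apply/ler_addgt0Pl => e e0; rewrite addr0.
have c0 : 0 < `|c| + 1 by rewrite ltr_wpDl.
apply: le_trans (h (e / (`|c| + 1)) _) _; first by rewrite divr_gt0.
rewrite mulrAC ler_pdivrMr// ler_wpM2l ?(ltW e0)//.
by have := ler_norm c; lra.
Qed.

Lemma rnorm_eq0_small x c : (forall e : R, 0 < e -> rnorm x <= e * c) -> x = 0.
Proof. by move=> /le0_small h; apply/rnorm_eq0/le_anti; rewrite rnorm_ge0 andbT. Qed.

Lemma rinner_le x y : `|rinner x y| <= rnorm x * rnorm y.
Proof.
rewrite ler_norml rinner_cauchy andbT lerNl -rinnerNl; apply: le_trans (rinner_cauchy _ _) _.
by rewrite rnormN.
Qed.

Definition spec T : R -> Prop := fun t => spectrum T t%:C.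

Definition op_approx (q : nat -> {poly R}) T S :=
  forall e : R, 0 < e -> \forall n \near \oo,
    forall x, rnorm (poly_op (q n) T x - S x) <= e * rnorm x.

Lemma is_funcalcP g T S : is_funcalc g T S <->
  blin S /\ exists q, poly_approx q (spec T) g /\ op_approx q T S.
Proof.
split=> -[bS [q [h1 h2]]]; (split; first by apply/blinP); exists q; split=> // e e0.
  by move: (h2 e e0); apply: filterS => n h x; have := h x; rewrite -lecR rmorphM/= !rnormE.
by move: (h2 e e0); apply: filterS => n h x; have := h x; rewrite -lecR rmorphM/= !rnormE.
Qed.

Lemma is_funcalc_ext g h T S : (forall t, spec T t -> g t = h t) ->
  is_funcalc g T S -> is_funcalc h T S.
Proof.
move=> gh [bS [q [h1 h2]]]; split=> //; exists q; split=> // e e0.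
by move: (h1 e e0); apply: filterS => n hn t st; rewrite -gh//; exact: hn.
Qed.

Lemma is_funcalc_poly (q : {poly R}) T : blin T -> is_funcalc (horner q) T (poly_op q T).
Proof.
move=> bT; apply/is_funcalcP; split; first exact: poly_op_blin.
exists (fun=> q); split=> e e0; apply: nearW => n x.
  by rewrite subrr normr0 ltW.
by rewrite subrr rnorm0 mulr_ge0 ?rnorm_ge0// ltW.
Qed.

Lemma is_funcalc_symm g T S : blin T -> symm T -> is_funcalc g T S -> symm S.
Proof.
move=> bT sT /is_funcalcP[bS [q [_ hq]]] x y.
apply/eqP; rewrite -subr_eq0 -normr_le0; apply/eqP.
apply/eqP; apply: (@le0_small _ (2 * (rnorm x * rnorm y))) => e e0.
have [n0 _ /(_ n0 (leqnn _)) hn] := hq e e0.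
have -> : rinner (S x) y - rinner x (S y) =
   rinner x (poly_op (q n0) T y - S y) - rinner (poly_op (q n0) T x - S x) y.
  by rewrite rinnerBl rinnerBr (poly_op_symm (q n0) bT sT x y); ring.
apply: le_trans (ler_normB _ _) _.
have h1 := rinner_le x (poly_op (q n0) T y - S y).
have h2 := rinner_le (poly_op (q n0) T x - S x) y.
have h3 := ler_wpM2l (rnorm_ge0 x) (hn y); have h4 := ler_wpM2r (rnorm_ge0 y) (hn x).
lra.
Qed.

Lemma is_funcalc_le g h T S S' : blin T -> symm T -> is_funcalc g T S -> is_funcalc h T S' ->
  (forall t, spec T t -> g t <= h t) -> forall x, rinner (S x) x <= rinner (S' x) x.
Proof.
move=> bT sT /is_funcalcP[bS [q [hg hq]]] /is_funcalcP[bS' [r [hh hr]]] gh x.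
rewrite -subr_le0; apply: (@le0_small _ (4 * rnorm x ^+ 2)) => e e0.
have [n _ /(_ n (leqnn _))[[h1 h2] [h3 h4]]] :=
  filterI (filterI (hg e e0) (hq e e0)) (filterI (hh e e0) (hr e e0)).
(* On the spectrum r_n - q_n >= h - g - 2 e. Replacing the polynomials by S' and S costs another 2 e
   |x|^2, whence the factor 4. *)
have pos : 0 <= rinner (poly_op (r n - q n + (2 * e)%:P) T x) x.
  apply: spectral_ge0 => // t st; rewrite !hornerE.
  have := h1 t st; have := h3 t st; have := gh t st; rewrite !ler_norml => ? /andP[? ?] /andP[? ?].
  lra.
move: pos; rewrite poly_opD poly_opB poly_opC rinnerDl rinnerBl rinnerZl -rnorm_sq => pos.
have b1 := rinner_le (poly_op (q n) T x - S x) x.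
have b2 := rinner_le (poly_op (r n) T x - S' x) x.
have b3 := ler_wpM2r (rnorm_ge0 x) (h2 x); have b4 := ler_wpM2r (rnorm_ge0 x) (h4 x).
rewrite -mulrA -expr2 in b3 b4; rewrite !ler_norml !rinnerBl in b1 b2.
move/andP: b1 => [? ?]; move/andP: b2 => [? ?]; lra.
Qed.

(** A zero form is nonnegative, so [form_cauchy] at x and S x gives |S x|^4 <= 0. *)
Lemma symm_form0 S : linear S -> symm S -> (forall x, rinner (S x) x = 0) -> forall x, S x = 0.
Proof.
move=> lS sS S0 x; have := form_cauchy x (S x) lS sS.
rewrite S0 mul0r -rnorm_sq => h; apply/rnorm_eq0/eqP.
by rewrite -sqrf_eq0 -sqrf_eq0 eq_le sqr_ge0 andbT h// => u; rewrite S0.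
Qed.

(** Comparing g with itself in both directions shows that S - S' has zero form. *)
Lemma is_funcalc_unique g T S S' : blin T -> symm T ->
  is_funcalc g T S -> is_funcalc g T S' -> S = S'.
Proof.
move=> bT sT f f'; apply/funext => x; apply/eqP; rewrite -subr_eq0; apply/eqP.
have bS := (is_funcalcP _ _ _).1 f; have bS' := (is_funcalcP _ _ _).1 f'.
apply: (@symm_form0 (S - S')).
- by have [] := blin_sub bS.1 bS'.1.
- by apply: symm_sub; [exact: is_funcalc_symm f | exact: is_funcalc_symm f'].
move=> y; rewrite opsubE rinnerBl; apply/eqP; rewrite subr_eq0 eq_le.
by apply/andP; split; [apply: is_funcalc_le bT sT f f' _ y | apply: is_funcalc_le bT sT f' f _ y].
Qed.

Lemma funcalcE g T S : blin T -> symm T -> is_funcalc g T S -> funcalc g T = S.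
Proof.
move=> bT sT f; apply: xget_unique => // S' f'; exact: is_funcalc_unique f' f.
Qed.

(** By [spectral_norm], uniform convergence on the spectrum makes q_n(T) Cauchy in operator norm;
    completeness of H gives the limit pointwise. *)
Lemma is_funcalc_ex g T (q : nat -> {poly R}) : blin T -> symm T ->
  poly_approx q (spec T) g -> is_funcalc g T (funcalc g T).
Proof.
move=> bT sT hq.
suff [S hS] : exists S, is_funcalc g T S by rewrite (funcalcE bT sT hS).
have cau e : 0 < e -> exists n0, forall n m, (n0 <= n)%N -> (n0 <= m)%N -> forall x,
    rnorm (poly_op (q n) T x - poly_op (q m) T x) <= e * rnorm x.
  move=> e0; have [|n0 _ hn] := hq (e / 2); first by rewrite divr_gt0.
  exists n0 => n m nn mm x; rewrite -poly_opB; apply: spectral_norm => // [|t st]; first exact: ltW.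
  have := hn n nn t st; have := hn m mm t st.
  rewrite !hornerE !ler_norml => /andP[? ?] /andP[? ?]; apply/andP; split; lra.
have /choice[S hS] : forall x, exists l, forall e : R, 0 < e -> exists n0, forall n, (n0 <= n)%N ->
    rnorm (poly_op (q n) T x - l) <= e.
  move=> x; apply: complete_seq => e e0.
  have c0 : 0 < rnorm x + 1 by rewrite ltr_wpDl// rnorm_ge0.
  have [|n0 hn] := cau (e / (rnorm x + 1)); first by rewrite divr_gt0.
  exists n0 => n m h1 h2; apply: le_trans (hn n m h1 h2 x) _.
  by rewrite mulrAC ler_pdivrMr// ler_wpM2l ?(ltW e0)// lerDl.
have unif : op_approx q T S.
  move=> e e0; have [n0 hn] := cau e e0; exists n0 => // n /= nn x.
  (* Only n1 depends on x; passing through the larger index gives a bound uniform in x, up to an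
     arbitrary d. *)
  apply/ler_addgt0Pr => d d0; have [n1 hn1] := hS x d d0.
  have -> : poly_op (q n) T x - S x = (poly_op (q n) T x - poly_op (q (maxn n0 n1)) T x) +
     (poly_op (q (maxn n0 n1)) T x - S x) by rewrite addrA subrK.
  apply: le_trans (rnormD _ _) _; apply: lerD.
    by apply: hn => //; exact: leq_maxl.
  by apply: hn1; exact: leq_maxr.
exists S; apply/is_funcalcP; split; last by exists q.
split.
  move=> k x y; apply/eqP; rewrite -subr_eq0; apply/eqP.
  apply: (@rnorm_eq0_small _ (rnorm (k *: x + y) + complex.Re `|k| * rnorm x + rnorm y)) => e e0.
  have [n0 _ /(_ n0 (leqnn _)) hn] := unif e e0.
  have lP := (poly_op_blin (q n0) bT).1.
  have -> : S (k *: x + y) - (k *: S x + S y) =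
     - (poly_op (q n0) T (k *: x + y) - S (k *: x + y)) +
     k *: (poly_op (q n0) T x - S x) + (poly_op (q n0) T y - S y).
    by rewrite lP scalerBr opprB -[RHS]addrA [X in _ = _ + X]addrACA -opprD addrA subrK.
  apply: le_trans (rnormD _ _) _; apply: le_trans (lerD (rnormD _ _) (lexx _)) _; rewrite rnormN.
  have h1 := hn (k *: x + y); have h2 := hn y.
  have h3 := rnormZ_le k (poly_op (q n0) T x - S x).
  have k0 : 0 <= complex.Re `|k|.
    by rewrite -lecR (RRe_real (normr_real k)); exact: normr_ge0.
  have h4 := ler_wpM2l k0 (hn x).
  lra.
have [n0 _ /(_ n0 (leqnn _)) hn] := unif 1 ltr01.
have [_ [K K0 hK]] := poly_op_blin (q n0) bT.
exists (K + 1); first by rewrite addr_gt0.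
move=> x; have -> : S x = - (poly_op (q n0) T x - S x) + poly_op (q n0) T x by rewrite opprB subrK.
by apply: le_trans (rnormD _ _) _; rewrite rnormN mulrDl addrC lerD.
Qed.

Lemma is_funcalc_comp g h T S S' B : blin T ->
  (forall t, spec T t -> `|g t| <= B) -> (forall t, spec T t -> `|h t| <= B) ->
  is_funcalc g T S -> is_funcalc h T S' -> is_funcalc (fun t => g t * h t) T (S \o S').
Proof.
move=> bT gB hB /is_funcalcP[bS [q [hg hq]]] /is_funcalcP[bS' [r [hh hr]]].
apply/is_funcalcP; split; first exact: blin_comp.
have [lS [K K0 hK]] := bS; have [lS' [K' K'0 hK']] := bS'.
exists (fun n => q n * r n); split=> e e0.
  (* As d <= 1, the product of the two errors is at most d; the two cross terms are at most d |B|
     each. *)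
  pose d := Num.min 1 (e / (2 * `|B| + 1)).
  have B0 : 0 < 2 * `|B| + 1 by rewrite ltr_wpDl// mulr_ge0.
  have d0 : 0 < d by rewrite lt_min ltr01 divr_gt0.
  have d1 : d <= 1 by rewrite ge_min lexx.
  have d2 : d * (2 * `|B| + 1) <= e by rewrite -ler_pdivlMr// ge_min lexx orbT.
  move: (hg d d0) (hh d d0); apply: filterS2 => n h1 h2 t st.
  have {}h1 := h1 t st; have {}h2 := h2 t st.
  have -> : (q n * r n).[t] - g t * h t =
      ((q n).[t] - g t) * ((r n).[t] - h t) + ((q n).[t] - g t) * h t + g t * ((r n).[t] - h t).
    by rewrite hornerM; ring.
  apply: le_trans (ler_normD _ _) _; apply: le_trans (lerD (ler_normD _ _) (lexx _)) _.
  rewrite !normrM.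
  have a1 : `|(q n).[t] - g t| * `|(r n).[t] - h t| <= d * 1.
    by apply: ler_pM => //; apply: le_trans d1.
  have B1 := ler_norm B.
  have a2 : `|(q n).[t] - g t| * `|h t| <= d * `|B|.
    by apply: ler_pM => //; apply: le_trans (hB t st) _.
  have a3 : `|g t| * `|(r n).[t] - h t| <= `|B| * d.
    by apply: ler_pM => //; apply: le_trans (gB t st) _.
  lra.
(* As d <= 1, r_n(T) is bounded by K' + 1, so the two errors are at most d (K' + 1) and K d. *)
pose d := Num.min 1 (e / (K' + 1 + K)).
have B0 : 0 < K' + 1 + K by lra.
have d0 : 0 < d by rewrite lt_min ltr01 divr_gt0.
have d1 : d <= 1 by rewrite ge_min lexx.
have d2 : d * (K' + 1 + K) <= e by rewrite -ler_pdivlMr// ge_min lexx orbT.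
move: (hq d d0) (hr d d0); apply: filterS2 => n h1 h2 x.
have {}h1 := h1 (poly_op (r n) T x); have {}h2 := h2 x.
have -> : poly_op (q n * r n) T x - (S \o S') x =
   (poly_op (q n) T (poly_op (r n) T x) - S (poly_op (r n) T x)) +
   S (poly_op (r n) T x - S' x).
  by rewrite poly_opM// (linB lS) addrA subrK.
apply: le_trans (rnormD _ _) _.
have h3 := hK (poly_op (r n) T x - S' x).
have h4 : rnorm (poly_op (r n) T x) <= (K' + 1) * rnorm x.
  rewrite -[poly_op (r n) T x](subrK (S' x)); apply: le_trans (rnormD _ _) _.
  have h5 : d * rnorm x <= 1 * rnorm x by rewrite ler_wpM2r ?rnorm_ge0.
  have := hK' x; lra.
have h6 := ler_wpM2l (ltW d0) h4; have h7 := ler_wpM2l (ltW K0) h2.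
have h8 := ler_wpM2r (rnorm_ge0 x) d2.
lra.
Qed.

End calculus.

(** * Powers and means of positive operators *)

Section means.
Context {R : realType} {H : hilbertType R}.
Implicit Types (x y z : H) (a b c m M lam p : R) (A B S T : H -> H) (g h : R -> R).

Definition form_bounds a b T :=
  forall x, a * rnorm x ^+ 2 <= rinner (T x) x <= b * rnorm x ^+ 2.

Lemma spec_bounds a b T : blin T -> symm T -> form_bounds a b T ->
  forall t, spec T t -> a <= t <= b.
Proof.
move=> bT sT ab t st; apply/andP; split.
  by apply: (spectrum_ge bT sT _ st) => x; case/andP: (ab x).
by apply: (spectrum_le bT sT _ st) => x; case/andP: (ab x).
Qed.

Lemma is_funcalc_lipschitz a b g T : blin T -> symm T -> a < b -> form_bounds a b T ->
  lipschitz_seg a b g -> is_funcalc g T (funcalc g T).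
Proof.
move=> bT sT ab fT /(lipschitz_poly_approx ab)[q hq].
apply: (is_funcalc_ex bT sT (q := q)) => e /hq; apply: filterS => n hn t st.
by apply: hn; exact: spec_bounds st.
Qed.

(** The strict a < b gives a nondegenerate segment for the Bernstein approximation, and 0 < a makes
    powers Lipschitz on it. *)
Definition pos_def a b T := [/\ blin T, symm T, 0 < a < b & form_bounds a b T].

Lemma pos_defP T : blin T -> symm T -> (forall x, 0 <= rinner (T x) x) -> op_invertible T ->
  exists a b, pos_def a b T.
Proof.
move=> bT sT pT iT; have [a a0 ha] := symm_ge0_coercive bT sT pT iT.
have [_ [K K0 hK]] := bT.
exists a, (a + K); split=> //; first by rewrite a0 ltrDl.
move=> x; rewrite ha /=; apply: le_trans (rinner_cauchy _ _) _.
have := ler_wpM2r (rnorm_ge0 x) (hK x); rewrite -mulrA -expr2.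
have : 0 <= a * rnorm x ^+ 2 by rewrite mulr_ge0 ?sqr_ge0// ltW.
lra.
Qed.

Lemma op_pow_funcalc a b A r : pos_def a b A ->
  is_funcalc (fun t => t `^ r) A (op_pow A r).
Proof.
move=> [bA sA /andP[a0 ab] fA].
by apply: (is_funcalc_lipschitz bA sA ab fA); exact: powR_lipschitz.
Qed.

Lemma op_powD a b A r s : pos_def a b A -> op_pow A r \o op_pow A s = op_pow A (r + s).
Proof.
move=> pA; have [bA sA /andP[a0 ab] fA] := pA.
have pos := spec_bounds bA sA fA.
(* The right side is symmetric in u and v, so one constant serves both factors in
   [is_funcalc_comp]. *)
have bound t u v : spec A t -> `|t `^ u| <= (a `^ u + b `^ u) + (a `^ v + b `^ v).
  move=> /pos st; rewrite ger0_norm ?powR_ge0//; apply: le_trans (powR_le_ends _ a0 st) _.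
  by rewrite lerDl addr_ge0 ?powR_ge0.
apply: (is_funcalc_unique bA sA (g := fun t => t `^ (r + s))); last exact: op_pow_funcalc pA.
apply: (is_funcalc_ext (g := fun t => t `^ r * t `^ s)).
  move=> t /pos/andP[t1 _]; rewrite powRD//; apply/implyP => _.
  by rewrite gt_eqF//; exact: lt_le_trans t1.
apply: (is_funcalc_comp (B := (a `^ r + b `^ r) + (a `^ s + b `^ s)) bA).
- by move=> t; exact: bound.
- by move=> t; rewrite addrC; exact: bound.
- exact: op_pow_funcalc pA.
- exact: op_pow_funcalc pA.
Qed.

Lemma op_pow0 a b A : pos_def a b A -> op_pow A 0 = idfun.
Proof.
move=> pA; have [bA sA _ _] := pA.
apply: (is_funcalc_unique bA sA (op_pow_funcalc 0 pA)).
have -> : (idfun : H -> H) = poly_op 1%:P A.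
  by apply/funext => x; rewrite poly_opC scale1r.
apply: (is_funcalc_ext _ (is_funcalc_poly _ bA)) => t _ /=.
by rewrite hornerC powRr0.
Qed.

Lemma op_pow1 a b A : pos_def a b A -> op_pow A 1 = A.
Proof.
move=> pA; have [bA sA /andP[a0 _] fA] := pA.
apply: (is_funcalc_unique bA sA (op_pow_funcalc 1 pA)).
have {2}-> : A = poly_op (1%:P * 'X) A.
  by apply/funext => x; rewrite poly_opMX poly_opC scale1r.
apply: (is_funcalc_ext _ (is_funcalc_poly _ bA)) => t /(spec_bounds bA sA fA)/andP[t1 _] /=.
by rewrite !hornerE powRr1//; apply: le_trans t1; exact: ltW.
Qed.

Section mean.
Variables (a b m M : R) (A B : H -> H).
Hypotheses (pA : pos_def a b A) (bB : blin B) (sB : symm B) (mM : m < M).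
Hypothesis mB : forall x, m * rinner (A x) x <= rinner (B x) x.
Hypothesis BM : forall x, rinner (B x) x <= M * rinner (A x) x.

Local Notation U := (op_pow A 2^-1).
Local Notation V := (op_pow A (- 2^-1)).
Local Notation T := (V \o B \o V).

Let UU x : U (U x) = A x.
Proof.
rewrite -[LHS]/((U \o U) x) (op_powD _ _ pA) -{2}(op_pow1 pA).
by congr (op_pow A _ x); lra.
Qed.
Let UV x : U (V x) = x.
Proof. by rewrite -[LHS]/((U \o V) x) (op_powD _ _ pA) subrr (op_pow0 pA). Qed.
Let VU x : V (U x) = x.
Proof. by rewrite -[LHS]/((V \o U) x) (op_powD _ _ pA) addNr (op_pow0 pA). Qed.

Let bsU r : blin (op_pow A r) /\ symm (op_pow A r).
Proof.
have [bA sA _ _] := pA; have f := op_pow_funcalc r pA.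
by split; [case/is_funcalcP: f | exact: is_funcalc_symm f].
Qed.

Let bT : blin T.
Proof. by apply: blin_comp (bsU _).1; apply: blin_comp => //; exact: (bsU _).1. Qed.
Let sT : symm T.
Proof. by move=> x y; rewrite /= (bsU _).2 sB (bsU _).2. Qed.
(** The hypotheses are evaluated at V x, where <T x, x> = <B V x, V x> and |x|^2 = <A V x, V x>. *)
Let fT : form_bounds m M T.
Proof.
move=> x; have e : rnorm x ^+ 2 = rinner (A (V x)) (V x).
  by rewrite -UU UV (bsU _).2 UV rnorm_sq.
by rewrite /= (bsU _).2 e mB BM.
Qed.

(** An affine function is a polynomial, so the mean is U (lam T + 1 - lam) U, which expands by U T U
    = B and U U = A. *)
Lemma op_mean_aff lam : op_mean (aff lam) A B = (1 - lam)%:C *: A + lam%:C *: B.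
Proof.
have -> : op_mean (aff lam) A B = U \o poly_op (lam%:P * 'X + (1 - lam)%:P) T \o U.
  congr (_ \o _ \o _); apply: (funcalcE bT sT).
  apply: (is_funcalc_ext _ (is_funcalc_poly _ bT)) => t _.
  by rewrite /aff !(hornerD, hornerM, hornerX, hornerC); ring.
apply/funext => x; rewrite /= poly_opD poly_opMX !poly_opC /= VU.
by rewrite (linD (bsU _).1.1) !(linZ (bsU _).1.1) UV UU addrC.
Qed.

Lemma op_mean_blin_symm g : lipschitz_seg m M g -> blin (op_mean g A B) /\ symm (op_mean g A B).
Proof.
move=> lg; have f := is_funcalc_lipschitz bT sT mM fT lg.
have bG := ((is_funcalcP _ _ _).1 f).1; have sG := is_funcalc_symm bT sT f.
split; first by apply: blin_comp (bsU _).1; apply: blin_comp => //; exact: (bsU _).1.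
by move=> x y; rewrite /op_mean/= (bsU _).2 sG (bsU _).2.
Qed.

(** The scalar inequality on the spectrum of T compares forms, taken here at U x. *)
Lemma op_mean_ge g lam al be : lipschitz_seg m M g ->
  (forall t, m <= t <= M -> al * aff lam t + be <= g t) ->
  forall x, al * rinner (op_mean (aff lam) A B x) x + be * rinner (A x) x <=
    rinner (op_mean g A B x) x.
Proof.
move=> lg hg x; have f := is_funcalc_lipschitz bT sT mM fT lg.
pose q : {poly R} := al%:P * (lam%:P * 'X + (1 - lam)%:P) + be%:P.
have fq : is_funcalc (fun t => al * aff lam t + be) T (poly_op q T).
  apply: (is_funcalc_ext _ (is_funcalc_poly _ bT)) => t _.
  by rewrite /q /aff !(hornerD, hornerM, hornerX, hornerC); ring.
have := is_funcalc_le bT sT fq f (fun t st => hg t (spec_bounds bT sT fT st)) (U x).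
have e1 : rinner (T (U x)) (U x) = rinner (B x) x by rewrite /= VU (bsU _).2 VU.
have e2 : rinner (U x) (U x) = rinner (A x) x by rewrite -(bsU _).2 UU.
have -> : rinner (op_mean g A B x) x = rinner (funcalc g T (U x)) (U x).
  by rewrite /op_mean/= (bsU _).2.
apply: le_trans; rewrite /q poly_opD poly_opM// !poly_opC poly_opD poly_opMX !poly_opC op_mean_aff.
rewrite opaddE !opscaleE !(rinnerDl, rinnerZl) e1 e2 le_eqVlt; apply/orP; left; apply/eqP.
by ring.
Qed.
End mean.

(** The affine map sends [m, M] into a segment of positive numbers with slope lam <= 1, so a
    Lipschitz constant of the power there carries over. *)
Lemma aff_lipschitz lam p m M : 0 <= lam <= 1 -> 0 < m ->
  lipschitz_seg m M (fun t => aff lam t `^ p).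
Proof.
move=> lam01 m0; have [L L0 hL] := @powR_lipschitz _ (aff lam m) (aff lam M) p (aff_gt0 lam01 m0).
have mono s t : s <= t -> aff lam s <= aff lam t.
  by move=> st; rewrite /aff lerD2l ler_wpM2l//; case/andP: lam01.
exists L => // s t /andP[s1 s2] /andP[t1 t2].
apply: le_trans (hL _ _ _ _) _; rewrite ?mono//.
have -> : aff lam s - aff lam t = lam * (s - t) by rewrite /aff; ring.
have /andP[l0 l1] := lam01.
by rewrite normrM (ger0_norm l0) ler_pM2l// ler_piMl.
Qed.

Lemma op_gt0_scale m A : 0 < m -> blin A -> op_gt0 (m%:C *: A) -> symm (m%:C *: A) ->
  exists a b, pos_def a b A.
Proof.
move=> m0 bA [/op_ge0_rinner pA iA] smA.
have sA : symm A.
  move=> x y; have := smA x y; rewrite !opscaleE rinnerZl rinnerZr => /mulfI; apply.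
  by rewrite gt_eqF.
apply: pos_defP => //.
  by move=> x; have := pA x; rewrite opscaleE rinnerZl pmulr_rge0.
by apply: op_invertible_scale iA; rewrite (inj_eq (@complexI R) _ 0) gt_eqF.
Qed.

Lemma op_le_rinner S T : linear S -> linear T -> op_le S T ->
  [/\ symm S, symm T & forall x, rinner (S x) x <= rinner (T x) x].
Proof.
move=> lS lT [/symmP-/(_ lS) sS /symmP-/(_ lT) sT /op_ge0_rinner h]; split=> // x.
by have := h x; rewrite opsubE rinnerBl subr_ge0.
Qed.

End means.

(** * The operator inequality *)

Lemma rinner_sum {R : realType} {H : hilbertType R} n (F : 'I_n -> H) (x : H) :
  rinner (\sum_j F j) x = \sum_j rinner (F j) x.
Proof. by elim/big_rec2: _ => [|j y z _ <-]; rewrite ?rinner0l// rinnerDl. Qed.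

Theorem corollary2p4 (R : realType) (H : hilbertType R) (n : nat)
    (A B : 'I_n -> (H -> H)) (m M p lam : R)
    (hA : forall j, bounded_op (A j)) (hB : forall j, bounded_op (B j))
    (hm0 : 0 < m) (hm1 : m < 1) (hM1 : 1 < M)
    (hAB : forall j, [/\ op_gt0 (m%:C *: A j),
                         op_le (m%:C *: A j) (B j) &
                         op_le (B j) (M%:C *: A j)])
    (hsum : let IA := idfun - \sum_j A j in
            let IB := idfun - \sum_j B j in
            [/\ op_gt0 (m%:C *: IA),
                op_le (m%:C *: IA) IB &
                op_le IB (M%:C *: IA)])
    (hp : 0 <= p <= 1) (hlam : 0 <= lam <= 1) :
  let f := aff lam in
  op_le
    (op_pow (idfun - \sum_j op_mean f (A j) (B j)) p)
    ((delta lam p m M)%:C *: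
       ((f m `^ p)%:C *: (\sum_j A j) +
        op_mean (fun t => f t `^ p) (idfun - \sum_j A j) (idfun - \sum_j B j))).
Proof.
have mM : m < M by lra.
(* The pairs (A_j, B_j) and the pair (C, D) satisfy the same hypotheses, so the form inequalities
   are extracted once for both. *)
have ctx (S T : H -> H) : blin S -> blin T -> op_gt0 (m%:C *: S) ->
    op_le (m%:C *: S) T -> op_le T (M%:C *: S) ->
    (exists a b, pos_def a b S) /\ [/\ symm T,
      forall x, m * rinner (S x) x <= rinner (T x) x &
      forall x, rinner (T x) x <= M * rinner (S x) x].
  move=> bS bT pS l1 l2.
  have [smS sT h1] := op_le_rinner (blin_scale _ bS).1 bT.1 l1.
  have [_ _ h2] := op_le_rinner bT.1 (blin_scale _ bS).1 l2.
  split; first exact: op_gt0_scale smS.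
  split=> // x; first by have := h1 x; rewrite opscaleE rinnerZl.
  by have := h2 x; rewrite opscaleE rinnerZl.
have {}hA j : blin (A j) by apply/blinP.
have {}hB j : blin (B j) by apply/blinP.
have hj j := let: And3 h1 h2 h3 := hAB j in ctx _ _ (hA j) (hB j) h1 h2 h3.
move: hsum => /=; set C : H -> H := _ - _; set D : H -> H := _ - \sum_j B j => -[c1 c2 c3].
have bC : blin C by apply: blin_sub; [exact: blin_id | exact: blin_sum].
have bD : blin D by apply: blin_sub; [exact: blin_id | exact: blin_sum].
have [[a [b pC]] [sD mD DM]] := ctx _ _ bC bD c1 c2 c3.
have CE x : C x = x - \sum_j A j x by rewrite /C opsubE fct_sumE.
have DE x : D x = x - \sum_j B j x by rewrite /D opsubE fct_sumE.
set Y := idfun - \sum_j op_mean (aff lam) (A j) (B j).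
have YE : Y = (1 - lam)%:C *: C + lam%:C *: D.
  apply/funext => x; rewrite /Y opsubE fct_sumE opaddE !opscaleE CE DE /=.
  under eq_bigr => j _.
    have [[a' [b' pA]] [sB _ _]] := hj j.
    rewrite (op_mean_aff pA (hB j) sB) opaddE !opscaleE; over.
  rewrite big_split/= -!scaler_sumr !scalerBr addrACA -scalerDl -opprD.
  by rewrite rmorphB/= subrK scale1r.
have [_ sC /andP[a0 ab] fC] := pC.
have AC x : 0 <= rnorm x ^+ 2 - rinner (C x) x.
  rewrite CE rinnerBl rnorm_sq opprB addrC subrK rinner_sum; apply: sumr_ge0 => j _.
  have [[a' [b' [_ _ /andP[a'0 _] fA]]] _] := hj j.
  case/andP: (fA x) => h _; apply: le_trans h.
  by rewrite mulr_ge0 ?sqr_ge0// ltW.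
have [al [be [al0 fm chord tangent]]] := delta_chord hm0 hm1 hM1 hp hlam.
have fm0 := aff_gt0 hlam hm0.
have lip := @aff_lipschitz R lam p m M hlam hm0.
set G := op_mean _ C D.
have [bG sG] := op_mean_blin_symm pC bD sD mM mD DM lip.
have bY : blin Y by rewrite YE; apply: blin_add; exact: blin_scale.
have sY : symm Y by rewrite YE; apply: symm_add; exact: symm_scale.
have rinnerY x : rinner (Y x) x = (1 - lam) * rinner (C x) x + lam * rinner (D x) x.
  by rewrite YE opaddE !opscaleE rinnerDl !rinnerZl.
have /andP[lam0 lam1] := hlam.
have Ylow x : aff lam m * rinner (C x) x <= rinner (Y x) x.
  by rewrite rinnerY /aff (mulrDl (1 - lam)) lerD2l -mulrA ler_wpM2l.
have Yup x : rinner (Y x) x <= aff lam M * rinner (C x) x.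
  by rewrite rinnerY /aff (mulrDl (1 - lam)) lerD2l -mulrA ler_wpM2l.
have fmM : aff lam m <= aff lam M by rewrite /aff lerD2l ler_wpM2l// ltW.
(* The bounds come from f(m) C <= Y <= f(M) C. They stay strictly ordered because a < b, even when
   f(m) = f(M), as for lam = 0. *)
have pY : pos_def (aff lam m * a) (aff lam M * b) Y.
  have fM0 : 0 < aff lam M by exact: lt_le_trans fmM.
  split=> //.
    rewrite mulr_gt0//=; apply: le_lt_trans (_ : aff lam M * a < _).
      by rewrite ler_wpM2r// ltW.
    by rewrite ltr_pM2l.
  move=> x; have /andP[h1 h2] := fC x; apply/andP; split.
    by apply: le_trans (Ylow x); rewrite -mulrA ler_pM2l.
  by apply: le_trans (Yup x) _; rewrite -mulrA ler_pM2l.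
have fY := op_pow_funcalc p pY.
have bYp := ((is_funcalcP _ _ _).1 fY).1; have sYp := is_funcalc_symm bY sY fY.
set d := delta lam p m M; have d0 : 0 <= d by apply: delta_ge0 => //; exact: ltW.
set RHS := d%:C *: _.
have bSA : blin (\sum_j A j) by exact: blin_sum.
have SAE : \sum_j A j = idfun - C by rewrite /C opprB addrC subrK.
have sSA : symm (\sum_j A j) by rewrite SAE; exact: symm_sub.
have bR : blin RHS by apply: blin_scale; apply: blin_add => //; exact: blin_scale.
have sR : symm RHS by apply: symm_scale; apply: symm_add => //; exact: symm_scale.
split; [exact/(symmP bYp.1)|exact/(symmP bR.1)|].
apply: rinner_op_ge0; [by have [] := blin_sub bR bYp|exact: symm_sub|] => x.
rewrite opsubE rinnerBl subr_ge0.
pose q : {poly R} := d%:P * (al%:P * 'X + be%:P).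
have fq : is_funcalc (fun t => d * (al * t + be)) Y (poly_op q Y).
  apply: (is_funcalc_ext _ (is_funcalc_poly _ bY)) => t _.
  by rewrite /q !(hornerD, hornerM, hornerX, hornerC); ring.
apply: le_trans (is_funcalc_le bY sY fY fq _ x) _.
  move=> t st; have [_ _ /andP[y0 _] fbY] := pY.
  have /andP[t1 t2] := spec_bounds bY sY fbY st.
  apply: tangent; first exact: lt_le_trans t1.
  (* For lam = 0, Y is C, whose spectrum is at most 1 since C <= I. *)
  move=> l0; apply: (spectrum_le bY sY _ st) => z.
  by rewrite rinnerY l0 subr0 mul0r addr0 !mul1r -subr_ge0; exact: AC.
have GE : al * rinner (Y x) x + be * rinner (C x) x <= rinner (G x) x.
  rewrite YE -(op_mean_aff pC bD sD).
  apply: (op_mean_ge pC bD sD mM mD DM lip) => t /andP[t1 t2]; apply: chord.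
  by rewrite /aff !lerD2l !ler_wpM2l.
have qE : rinner (poly_op q Y x) x = d * (al * rinner (Y x) x + be * rnorm x ^+ 2).
  rewrite /q poly_opM// poly_opC poly_opD poly_opMX !poly_opC.
  by rewrite rinnerZl rinnerDl !rinnerZl -rnorm_sq.
have RE : rinner (RHS x) x =
    d * (aff lam m `^ p * (rnorm x ^+ 2 - rinner (C x) x) + rinner (G x) x).
  by rewrite /RHS opscaleE rinnerZl opaddE opscaleE rinnerDl rinnerZl SAE opsubE rinnerBl -rnorm_sq.
rewrite qE RE ler_wpM2l//.
(* Since f(m)^p = al f(m) + be, what remains after [GE] is al f(m) (|x|^2 - <C x, x>) >= 0. *)
have := mulr_ge0 (mulr_ge0 al0 (ltW fm0)) (AC x).
rewrite -fm; lra.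
Qed.
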